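(* For $a,b,c\in\mathbb{R}$ such that $a>-1$, $b>-1$ and $c>\max\{0,a-b\}$ and for $d\in\{0,1\}$, let $\{P_n^{[d]}(x):=P_n^{[d]}(x;a,b,c)\}_{n\in\mathbb{N}}$ be the monic $2$-orthogonal polynomial sequence with respect to $\overline{\mathcal{W}}^{[d]}(x;a,b,c)$. Then the recurrence relation $$P_{n+1}^{[d]}(x)=\left(x-\beta_n^{[d]}\right)P_n^{[d]}(x)-\alpha_n^{[d]}P_{n-1}^{[d]}(x)-\gamma_{n-1}^{[d]}P_{n-2}^{[d]}(x),\qquad n\in\mathbb{N},\quad P_{-1}^{[d]}=P_{-2}^{[d]}=0,$$ holds, with recurrence coefficients $\beta_n^{[d]}=\beta_n^{[d]}(a,b,c)$ ($n\ge0$), $\alpha_n^{[d]}=\alpha_n^{[d]}(a,b,c)$ ($n\ge1$), $\gamma_n^{[d]}=\gamma_n^{[d]}(a,b,c)$ ($n\ge1$) given, for $m\in\mathbb{N}$ and $d\in\{0,1\}$, by $$\beta_{2m+d}^{[d]}(a,b,c)=\frac{(2m+d+1)(a+2m+d+1)(b+2m+d+1)}{c+b+3m+2d+1}-\frac{(2m+d)(a+2m+d)(b+2m+d)}{c+b+3m+2d},$$ $$\beta_{2m+d}^{[1-d]}(a,b,c)=\frac{(2m+d+1)(a+2m+d+1)(b+2m+d+1)}{c+b+3m+d+2}-\frac{(2m+d)(a+2m+d)(b+2m+d)}{c+b+3m+d}$$ (the second fraction in each being $0$ when $2m+d=0$), and, for $2m+d\ge1$, $$\alpha_{2m+d}^{[1-d]}(a,b,c+d)=\alpha_{2m+d}^{[d]}(a,b,c)=\frac{(2m+d)(a+2m+d)(b+2m+d)}{c+b+3m+2d}\Bigg(\frac{(2m+d-1)(a+2m+d-1)(b+2m+d-1)}{2(c+b+3m+2d-1)}$$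 $$\qquad-\frac{(2m+d)(a+2m+d)(b+2m+d)}{c+b+3m+2d}+\frac{(2m+d+1)(a+2m+d+1)(b+2m+d+1)}{2(c+b+3m+2d+1)}\Bigg),$$ $$\gamma_{2m+d}^{[d]}(a,b,c)=\frac{(2m+d)_2\,(a+2m+d)_2\,(b+2m+d)_2\,(c+m+d)(c+b-a+m+d)(c+b+m+d)}{(c+b+3m-1+2d)_3\,(c+b+3m+2d)_3},$$ $$\gamma_{2m+d}^{[1-d]}(a,b,c)=\frac{(2m+d)_2\,(a+2m+d)_2\,(b+2m+d)_2}{(c+b+3m+d)_3},$$ and $\gamma_m^{[d]}(a,b,c)>0$ for all $m\ge1$. Furthermore, the coefficients have the following periodic asymptotic behaviour of period $2$: as $m\to\infty$, $$\beta_{2m+d}^{[d]}(a,b,c)\sim\frac{28}{9}\,m,\qquad \beta_{2m+d}^{[1-d]}(a,b,c)\sim\frac{20}{9}\,m,$$ $$\alpha_{2m+d}^{[1-d]}(a,b,c+d)=\alpha_{2m+d}^{[d]}(a,b,c)\sim\frac{208}{81}\,m^2,$$ $$\gamma_{2m+d}^{[d]}(a,b,c)\sim\frac{2^6}{3^6}\,m^3,\qquad \gamma_{2m+d}^{[1-d]}(a,b,c)\sim\frac{2^6}{3^3}\,m^3.$$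
   Context: $\mathbb{N}=\{0,1,2,\dots\}$; $(z)_0=1$, $(z)_k=z(z+1)\cdots(z+k-1)$ is the Pochhammer symbol. For $\alpha>0$, $\beta\in\mathbb{R}$, $x>0$, the Tricomi function is $\mathbf{U}(\alpha,\beta;x)=\frac{1}{\Gamma(\alpha)}\int_0^\infty t^{\alpha-1}(t+1)^{\beta-\alpha-1}e^{-tx}\,dt$. For $a>-1$, $b>-1$, $c>\max\{0,a-b\}$ and $x>0$ define $$\mathcal{W}(x;a,b,c)=\frac{\Gamma(c+b+1)}{\Gamma(a+1)\Gamma(b+1)}\,e^{-x}x^a\,\mathbf{U}(c,a-b+1;x),\qquad \overline{\mathcal{W}}^{[d]}(x;a,b,c)=\begin{bmatrix}\mathcal{W}(x;a,b,c+d)\\ \mathcal{W}(x;a,b,c+1-d)\end{bmatrix},\quad d\in\{0,1\}.$$ A polynomial sequence $\{P_n\}_{n\in\mathbb{N}}$ ($\deg P_n=n$) is $2$-orthogonal with respect to a vector of weights $(w_0,w_1)$ on $(0,\infty)$ if for all $k,n\in\mathbb{N}$: $\int_0^\infty x^kP_n w_0\,dx=0$ if $n\ge 2k+1$ and $\neq0$ if $n=2k$; and $\int_0^\infty x^kP_n w_1\,dx=0$ if $n\ge 2k+2$ and $\neq 0$ if $n=2k+1$. *)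

(* Defs.v *)
From HB Require Import structures.
From mathcomp Require Export all_boot all_order all_algebra.
From mathcomp Require Export all_classical all_reals all_analysis.

Export Order.TTheory GRing.Theory Num.Theory.
Export numFieldNormedType.Exports.

#[export] Set Implicit Arguments.
#[export] Unset Strict Implicit.
#[export] Unset Printing Implicit Defensive.

Local Open Scope classical_set_scope.
Local Open Scope ring_scope.

Section Definitions.
Variable R : realType.
Implicit Types (a b c x z alpha beta : R) (n k d : nat) (P : nat -> {poly R}).

Local Notation mu := (@lebesgue_measure R).

Definition poch z k : R := \prod_(i < k) (z + i%:R).

(* Euler's integral; meaningful for 0 < z. *)
Definition Gamma z : R :=
  \int[mu]_(t in `]0, +oo[) (t `^ (z - 1) * expR (- t)).

Definition TricomiU alpha beta x : R :=
  (Gamma alpha)^-1 *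
  \int[mu]_(t in `]0, +oo[)
    (t `^ (alpha - 1) * (t + 1) `^ (beta - alpha - 1) * expR (- (t * x))).

Definition weightW a b c x : R :=
  Gamma (c + b + 1) / (Gamma (a + 1) * Gamma (b + 1)) *
  (expR (- x) * x `^ a * TricomiU c (a - b + 1) x).

Definition weight_vec d a b c : (R -> R) * (R -> R) :=
  (weightW a b (c + d%:R), weightW a b (c + 1 - d%:R)).

Definition poly_sequence P : Prop := forall n, size (P n) = n.+1.

(* [Rintegral] is the real part of the extended Lebesgue integral, with value 0
   when the latter is infinite. *)
Definition moment (w : R -> R) k (p : {poly R}) : R :=
  \int[mu]_(x in `]0, +oo[) (x ^+ k * p.[x] * w x).

Definition two_orthogonal (w : (R -> R) * (R -> R)) P : Prop :=
  poly_sequence P /\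
  forall k n : nat,
    [/\ (2 * k + 1 <= n)%N -> moment w.1 k (P n) = 0,
        n = (2 * k)%N -> moment w.1 k (P n) != 0,
        (2 * k + 2 <= n)%N -> moment w.2 k (P n) = 0
      & n = (2 * k + 1)%N -> moment w.2 k (P n) != 0].

Definition monic_two_orthogonal (w : (R -> R) * (R -> R)) P : Prop :=
  two_orthogonal w P /\ forall n, P n \is monic.

(* P_{n-j}, with P_{-1} = P_{-2} = 0. *)
Definition back P j n : {poly R} := if (j <= n)%N then P (n - j)%N else 0.

(* al 0 and ga 0 are irrelevant: they only multiply P_{-1} or P_{-2}. *)
Definition third_order_recurrence P (be al ga : nat -> R) : Prop :=
  forall n, P n.+1 = ('X - (be n)%:P) * P n - al n *: back P 1 n
                     - ga n.-1 *: back P 2 n.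

Definition asymptotically_equiv (u v : nat -> R) : Prop :=
  (u : nat -> R^o) ~_\oo (v : nat -> R^o).

End Definitions.

(* Main.v *)
From HB Require Import structures.
Require Import Defs.
From mathcomp Require Import measurable_realfun.
From mathcomp Require Import ring lra zify.

(** Why the theorem holds.

    The weight is a Laplace transform in disguise: Tonelli's theorem turns each
    of its moments into a Gamma function times a Beta integral over the
    half-line, so that, with the Pochhammer symbol (z)_n,

      m_n = (a+1)_n (b+1)_n / (c+b+1)_n

    is the n-th moment of W(x; a, b, c) ([integral_weightW]).  The two weights
    of the vector therefore differ only in whether the denominator starts at
    C = c + b + 1 or at C + 1.

    Explicit solution.  Put e = floor((n+d)/2) and let Q_n be the monic multiple
    of 2F2(-n, C+e; a+1, b+1; x), whose coefficient of degree j is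
    (-1)^(n-j) binom(n, j) times the product, over j <= i < n, of
    (a+1+i)(b+1+i)/(C+e+i).  Integrating Q_n against x^k and one of the weights
    gives an alternating binomial sum of values at j = 0, ..., n of a
    polynomial in j: e - k factors of (C)_(j+e) survive the division by
    (C)_(j+k), and the numerators contribute 2k more.  Its degree e + k is
    less than n, so the sum is an n-th finite difference that vanishes
    ([hyp_poly_orthogonal]).

    Uniqueness.  Enumerate the functionals p |-> integral of x^k p w_i by
    j = 2k + i.  On a 2-orthogonal sequence they form a triangular array with
    nonzero diagonal, so a polynomial of degree < n that the first n
    functionals annihilate is zero ([killed_by_dual_eq0]).  This is used twice.
    It gives P_n = Q_n, as the difference of two monic polynomials has degree
    < n.  It also gives the recurrence: multiplication by x shifts the
    functionals by two places, so the first n - 2 of them annihilate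
    x P_n - P_(n+1) - beta_n P_n - alpha_n P_(n-1) - gamma_(n-1) P_(n-2), and
    this vanishes as soon as its coefficients of degree >= n - 2 do.  The
    matter is thus reduced to the three leading coefficients below the top one,
    which are short rational functions ([rec_coef0], [rec_coef1],
    [rec_coef2]).

    The coefficients depend on the parity of n + d, because e jumps at every
    second step; this gives the two forms of beta and gamma.  The asymptotics
    follow after rewriting the differences in beta and alpha in terms of finite
    differences of the cubic s(a+s)(b+s), which removes the cancellation of
    leading terms. *)

Local Open Scope classical_set_scope.
Local Open Scope ring_scope.

(** * Finite differences of polynomials *)

Section FiniteDifferences.
Variable R : comNzRingType.

(** Pascal's rule: the (n+1)-st difference of [h] is the n-th difference of its
    first difference. *)
Lemma alternating_binomial_sum_recl n (h : nat -> R) :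
  \sum_(j < n.+2) (-1) ^+ (n.+1 - j) * 'C(n.+1, j)%:R * h j =
  \sum_(j < n.+1) (-1) ^+ (n - j) * 'C(n, j)%:R * (h j.+1 - h j).
Proof.
under [RHS]eq_bigr do rewrite mulrBr.
rewrite sumrB big_ord_recl [X in _ - X]big_ord_recl /= !subn0 !bin0 !mulr1.
under eq_bigr => i _.
  rewrite /bump leq0n add1n binS natrD mulrDr mulrDl subSS.
  over.
rewrite big_split /= [X in _ + (X + _)]big_ord_recr /= subnn bin_small// mulr0 mul0r addr0.
rewrite opprD [LHS]addrA [LHS]addrC; congr (_ + _).
rewrite exprS mulN1r mulNr; congr (_ + _).
rewrite -sumrN; apply: eq_bigr => i _.
by rewrite /bump leq0n add1n -(subnSK (ltn_ord i)) exprS mulN1r !mulNr.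
Qed.

End FiniteDifferences.

Section FiniteDifferencesPoly.
Variable R : idomainType.

(** Translation preserves the leading coefficient. *)
Lemma size_shift_sub (p : {poly R}) : (size (p \Po ('X + 1) - p)%R <= (size p).-1)%N.
Proof.
have sX : size ('X + 1 : {poly R}) = 2 by rewrite -[1]/(1%:P) size_XaddC.
have [->|p0] := eqVneq p 0; first by rewrite comp_poly0 subrr size_poly0.
have sc : size (p \Po ('X + 1)) = size p by rewrite size_comp_poly2// sX.
apply/leq_sizeP => j; rewrite leq_eqVlt => /predU1P[<-|pj].
  rewrite coefB -{1}sc.
  have := @lead_coef_comp R p ('X + 1); rewrite sX => /(_ isT).
  rewrite lead_coefDl ?size_polyX ?size_poly1// lead_coefX expr1n mulr1.
  by rewrite !lead_coefE => ->; rewrite subrr.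
by rewrite coefB !nth_default ?subrr// ?sc; move: pj; case: (size p).
Qed.

Lemma alternating_binomial_sum_poly n (p : {poly R}) : (size p <= n)%N ->
  \sum_(j < n.+1) (-1) ^+ (n - j) * 'C(n, j)%:R * p.[j%:R] = 0.
Proof.
elim: n p => [|n IH] p sp.
  move: sp; rewrite leqn0 size_poly_eq0 => /eqP ->.
  by rewrite big1// => i _; rewrite horner0 mulr0.
rewrite (@alternating_binomial_sum_recl _ n (fun j => p.[j%:R])).
rewrite -[RHS](IH (p \Po ('X + 1) - p)); last first.
  by apply: leq_trans (size_shift_sub p) _; move: sp; case: (size p).
apply: eq_bigr => i _; congr (_ * _).
by rewrite hornerD hornerN horner_comp hornerD hornerX hornerC -natr1.
Qed.

End FiniteDifferencesPoly.

(** * Functionals on polynomials *)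

Section MomentFunctional.
Variable R : comNzRingType.

(** The functional [p |-> L (x^k p)], where [L] is the functional with moment
    sequence [m]. *)
Definition moment_form (m : nat -> R) (k : nat) (p : {poly R}) : R :=
  \sum_(i < size p) p`_i * m (k + i)%N.

Lemma moment_form_widen m k n (p : {poly R}) : (size p <= n)%N ->
  moment_form m k p = \sum_(i < n) p`_i * m (k + i)%N.
Proof.
move=> pn; rewrite /moment_form (big_ord_widen n (fun i => p`_i * m (k + i)%N))//.
rewrite big_mkcond; apply: eq_bigr => i _.
by case: ltnP => // pi; rewrite nth_default// mul0r.
Qed.

Fact moment_form_is_scalar m k : scalar (moment_form m k).
Proof.
move=> c p q; pose n := maxn (size (c *: p + q)%R) (maxn (size p) (size q)).
rewrite !(@moment_form_widen m k n) ?leq_max ?leqnn ?orbT//.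
rewrite mulr_sumr -big_split; apply: eq_bigr => i _ /=.
by rewrite coefD coefZ mulrDl mulrA.
Qed.

HB.instance Definition _ m k :=
  GRing.isLinear.Build R {poly R} R _ (moment_form m k) (moment_form_is_scalar m k).

Lemma moment_formXM m k (p : {poly R}) : moment_form m k ('X * p) = moment_form m k.+1 p.
Proof.
rewrite (@moment_form_widen _ _ (size p).+1); last first.
  by rewrite (leq_trans (size_polyMleq _ _))// size_polyX.
rewrite big_ord_recl /= coefXM mul0r add0r; apply: eq_bigr => i _.
by rewrite /bump leq0n add1n coefXM/= addnS.
Qed.

End MomentFunctional.

Section Uniqueness.
Variables (R : fieldType) (P : nat -> {poly R}).
Hypothesis sizeP : forall n, size (P n) = n.+1.

Lemma graded_basis_expansion n (p : {poly R}) : (size p <= n)%N ->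
  exists c : nat -> R, p = \sum_(i < n) c i *: P i.
Proof.
elim: n p => [|n IH] p.
  rewrite leqn0 size_poly_eq0 => /eqP ->.
  by exists (fun=> 0); rewrite big_ord0.
move=> pn; have lP : (P n)`_n != 0.
  have -> : (P n)`_n = lead_coef (P n) by rewrite lead_coefE sizeP.
  by rewrite lead_coef_eq0 -size_poly_eq0 sizeP.
have /IH[c cE] : (size (p - (p`_n / (P n)`_n) *: P n)%R <= n)%N.
  apply/leq_sizeP => j; rewrite leq_eqVlt coefB coefZ => /predU1P[<-|nj].
    by rewrite divfK ?subrr.
  by rewrite (nth_default 0 (leq_trans pn nj)) [(P n)`_j]nth_default ?sizeP// mulr0 subrr.
exists (fun i => if i == n then p`_n / (P n)`_n else c i).
rewrite big_ord_recr /= eqxx -[LHS](subrK ((p`_n / (P n)`_n) *: P n)) cE.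
by congr (_ + _); apply: eq_bigr => i _; rewrite ltn_eqF.
Qed.

(** In the expansion of [p] along [P], triangularity of [L j (P l)] makes the
    coefficients vanish one after the other, starting from the lowest. *)
Lemma killed_by_dual_eq0 (L : nat -> {scalar {poly R}}) n (p : {poly R}) :
  (forall j l, (j < l)%N -> L j (P l) = 0) -> (forall j, L j (P j) != 0) ->
  (size p <= n)%N -> (forall j, (j < n)%N -> L j p = 0) -> p = 0.
Proof.
move=> L0 L1 /graded_basis_expansion[c ->] Lp.
suff c0 j : (j < n)%N -> c j = 0.
  by rewrite big1// => i _; rewrite c0// scale0r.
elim/ltn_ind: j => j IH jn.
have := Lp j jn; rewrite linear_sum (bigD1 (Ordinal jn)) //= linearZ /=.
rewrite big1 ?addr0; last first.
  move=> i; rewrite -val_eqE /= linearZ /= neq_ltn => /orP[ij|ji].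
    by rewrite IH// mul0r.
  by rewrite L0// mulr0.
by move/eqP; rewrite mulf_eq0 (negbTE (L1 j)) orbF => /eqP.
Qed.

End Uniqueness.

(** * The hypergeometric polynomials and their orthogonality *)

Section ProductLemmas.
Variables (R : comNzRingType) (F : nat -> R).

Lemma prod_nat_shift j k : \prod_(j <= i < j + k) F i = \prod_(0 <= i < k) F (j + i)%N.
Proof.
by rewrite -{1}[j]add0n big_addn addKn; apply: eq_bigr => i _; rewrite addnC.
Qed.

(** With [F i = z + i] these products are Pochhammer symbols.  This identity and
    [prod_nat_gap] isolate the factors of a term of the orthogonality sum that
    depend on [j], and these are polynomial in [j]. *)
Lemma prod_nat_overlap j n k : (j <= n)%N ->
  \prod_(j <= i < n) F i * \prod_(0 <= i < k + j) F i =
  \prod_(0 <= i < n) F i * \prod_(0 <= i < k) F (j + i)%N.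
Proof.
move=> jn; rewrite [(k + j)%N]addnC (@big_cat_nat _ _ _ j 0 (j + k)) ?leq_addr//=.
by rewrite (prod_nat_shift j k) mulrA [_ * \prod_(0 <= i < j) _]mulrC -big_cat_nat//=.
Qed.

Lemma prod_nat_gap j n k e : (j <= n)%N -> (k <= e)%N ->
  \prod_(j <= i < n) F (e + i)%N * \prod_(0 <= i < k + j) F i *
    \prod_(0 <= i < e - k) F (k + j + i)%N = \prod_(0 <= i < n + e) F i.
Proof.
move=> jn ke; rewrite -mulrA mulrC.
rewrite [RHS](@big_cat_nat _ _ _ (j + e)) ?leq_add2r//=; congr (_ * _).
  rewrite [RHS](@big_cat_nat _ _ _ (k + j)) ?[(k + j)%N]addnC ?leq_add2l//=; congr (_ * _).
  by rewrite -(prod_nat_shift (j + k)) -addnA subnKC.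
by rewrite big_addn addnK; apply: eq_bigr => i _; rewrite addnC.
Qed.

End ProductLemmas.

Section Hypergeometric.
Variable R : realType.
Implicit Types (a b c C f x : R).

(** The monic multiple of [2F2(-n, f; a+1, b+1; x)]. *)
Definition hyp_poly a b f n : {poly R} :=
  \poly_(j < n.+1) ((-1) ^+ (n - j) * 'C(n, j)%:R *
    \prod_(j <= i < n) ((a + 1 + i%:R) * (b + 1 + i%:R) / (f + i%:R))).

Definition moment_seq a b C n : R := poch (a + 1) n * poch (b + 1) n / poch C n.

Lemma moment_seqE a b C n :
  moment_seq a b C n = \prod_(i < n) ((a + 1 + i%:R) * (b + 1 + i%:R) / (C + i%:R)).
Proof. by rewrite /moment_seq /poch -big_split -prodf_div. Qed.

(** Up to the constant [K], the j-th term is the value at [j] of a product of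
    [2k] linear factors, from the numerators, and [e - k] linear factors, from
    the quotient of [(C)_(j+e)] by [(C)_(j+k)].  The total degree [e + k] is
    below [n], so the n-th difference vanishes. *)
Lemma hyp_poly_orthogonal a b C n k e : 0 < C -> (k <= e)%N -> (e + k < n)%N ->
  moment_form (moment_seq a b C) k (hyp_poly a b (C + e%:R) n) = 0.
Proof.
move=> C0 ke ekn.
have CN i : C + i%:R != 0 by rewrite gt_eqF// ltr_wpDr.
rewrite (@moment_form_widen _ _ _ n.+1) ?size_poly//.
pose s := [seq - (a + 1 + i%:R) | i <- iota 0 k] ++
          [seq - (b + 1 + i%:R) | i <- iota 0 k] ++
          [seq - (C + (k + i)%:R) | i <- iota 0 (e - k)].
pose p := \prod_(x <- s) ('X - x%:P).
pose v i := (a + 1 + i%:R) * (b + 1 + i%:R).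
pose K := \prod_(0 <= i < n) v i / \prod_(0 <= i < n + e) (C + i%:R).
transitivity (K * \sum_(j < n.+1) (-1) ^+ (n - j) * 'C(n, j)%:R * p.[j%:R]).
  rewrite mulr_sumr; apply: eq_bigr => -[j /=]; rewrite ltnS => jn _.
  rewrite moment_seqE coef_poly ltnS jn -[LHS]mulrA [RHS]mulrCA; congr (_ * _).
  have pE : p.[j%:R] = \prod_(0 <= i < k) v (j + i)%N *
      \prod_(0 <= i < e - k) (C + (k + j + i)%:R).
    rewrite /p horner_prod /s !big_cat !big_map /= mulrA; congr (_ * _).
      rewrite big_split /= /index_iota subn0.
      by congr (_ * _); apply: eq_bigr => i _; rewrite hornerXsubC natrD; ring.
    rewrite /index_iota subn0.
    by apply: eq_bigr => i _; rewrite hornerXsubC !natrD; ring.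
  rewrite pE /K -(big_mkord xpredT (fun i => v i / (C + i%:R))).
  rewrite -(@prod_nat_gap _ (fun i => C + i%:R) j n k e)//.
  under eq_bigr => i _ do rewrite -[C + _ + _]addrA -natrD.
  rewrite !prodf_div mulrACA -invfM (@prod_nat_overlap _ v)//.
  have G : \prod_(0 <= i < e - k) (C + (k + j + i)%:R) != 0
    by rewrite prodf_seq_neq0; apply/allP => i _; rewrite CN.
  by rewrite [in RHS]invfM [RHS]mulrACA; congr (_ * _); rewrite -mulrA mulVf// mulr1.
rewrite alternating_binomial_sum_poly ?mulr0// size_prod_XsubC.
by rewrite !size_cat !size_map !size_iota; lia.
Qed.

Lemma size_hyp_poly_le a b f n : (size (hyp_poly a b f n) <= n.+1)%N.
Proof. exact: size_poly. Qed.

Lemma hyp_poly_lead a b f n : (hyp_poly a b f n)`_n = 1.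
Proof. by rewrite coef_poly ltnSn subnn binn big_geq// !mulr1. Qed.

Definition cubic a b x := x * (a + x) * (b + x).

(** Since [binom(n, n-r)] contributes [n (n-1) ... / r!], the coefficients just
    below the top one are products of values of [cubic]. *)
Lemma hyp_poly_coef1 a b f n :
  (hyp_poly a b f n.+1)`_n = - (cubic a b n.+1%:R / (f + n%:R)).
Proof.
rewrite coef_poly ltnS leqnSn subSnn binSn big_nat1 /cubic -natr1.
by ring.
Qed.

Lemma hyp_poly_coef2 a b f n : 0 < f ->
  (hyp_poly a b f n.+2)`_n =
  cubic a b n.+2%:R * cubic a b n.+1%:R / (2 * (f + n.+1%:R) * (f + n%:R)).
Proof.
move=> f0; have fN i : f + i%:R != 0 by rewrite gt_eqF// ltr_wpDr.
rewrite coef_poly ltnS (leq_trans (leqnSn n))//.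
have -> : (n.+2 - n = 2)%N by lia.
rewrite big_nat_recr ?leqnSn//= big_nat1 /cubic.
have bE : 2 * 'C(n.+2, n)%:R = n.+2%:R * n.+1%:R :> R.
  have := mul_bin_down n.+2 n; rewrite /= binSn -!natrM => ->.
  by congr (_ * _)%:R; lia.
rewrite sqrrN expr1n mul1r; apply: (@mulfI _ 2) => //.
rewrite [LHS]mulrA bE -!natr1; field.
by rewrite fN natr1 fN.
Qed.

Lemma hyp_poly_coef3 a b f n : 0 < f ->
  (hyp_poly a b f n.+3)`_n =
  - (cubic a b n.+3%:R * cubic a b n.+2%:R * cubic a b n.+1%:R /
     (6 * (f + n.+2%:R) * (f + n.+1%:R) * (f + n%:R))).
Proof.
move=> f0; have fN i : f + i%:R != 0 by rewrite gt_eqF// ltr_wpDr.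
rewrite coef_poly ltnS (leq_trans (leqnSn n) (leqW (leqnSn _))).
have -> : (n.+3 - n = 3)%N by lia.
rewrite 2?big_nat_recr ?leqW ?leqnSn//= big_nat1 /cubic.
have bE : 6 * 'C(n.+3, n)%:R = n.+3%:R * n.+2%:R * n.+1%:R :> R.
  have B2 := mul_bin_down n.+2 n; have B3 := mul_bin_down n.+3 n.
  rewrite /= binSn in B2; rewrite /= in B3.
  rewrite -!natrM -mulnA B2 mulnCA B3; congr _%:R; lia.
apply: (@mulfI _ 6) => //.
rewrite [LHS]mulrA [6 * (_ * _)]mulrCA bE -!natr1; field.
by rewrite !natr1 !fN.
Qed.

End Hypergeometric.

(** * The recurrence relation of the hypergeometric polynomials *)

Section Recurrence.
Variable R : realType.
Implicit Types (a b c C f x : R) (P : nat -> {poly R}).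

(** The formulas remain right in degree 0, where the coefficient of ['X * p] is
    zero, because [cubic a b 0 = 0]. *)
Lemma hyp_polyXM_coef0 a b f n :
  ('X * hyp_poly a b f n)`_n = - (cubic a b n%:R / (f + n%:R - 1)).
Proof.
rewrite coefXM; case: n => [|n] /=; first by rewrite /cubic !mul0r oppr0.
by rewrite hyp_poly_coef1 -[X in f + X - 1]natr1 [f + (_ + 1)]addrA addrK.
Qed.

Lemma hyp_polyXM_coef1 a b f n : 0 < f ->
  ('X * hyp_poly a b f n.+1)`_n =
  cubic a b n.+1%:R * cubic a b n%:R / (2 * (f + n%:R) * (f + n%:R - 1)).
Proof.
move=> f0; rewrite coefXM; case: n => [|n] /=.
  by rewrite [X in _ * X / _]/cubic !(mul0r, mulr0).
by rewrite hyp_poly_coef2// -[X in f + X - 1]natr1 [f + (_ + 1)]addrA addrK.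
Qed.

Lemma hyp_polyXM_coef2 a b f n : 0 < f ->
  ('X * hyp_poly a b f n.+2)`_n =
  - (cubic a b n.+2%:R * cubic a b n.+1%:R * cubic a b n%:R /
     (6 * (f + n.+1%:R) * (f + n%:R) * (f + n%:R - 1))).
Proof.
move=> f0; rewrite coefXM; case: n => [|n] /=.
  by rewrite [X in _ * _ * X / _]/cubic !(mul0r, mulr0) oppr0.
by rewrite hyp_poly_coef3// -[X in f + X - 1]natr1 [f + (_ + 1)]addrA addrK.
Qed.

(** The last denominator [f + n - 1] in the coefficients of the n-th
    polynomial, where [f = c + b + 1 + floor((n+d)/2)]. *)
Definition rec_denom d b c n : R := c + b + n%:R + ((n + d)./2)%:R.

Definition rec_beta d a b c n : R :=
  cubic a b (n%:R + 1) / (rec_denom d b c n + 1 + (odd (n + d))%:R) -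
  cubic a b n%:R / rec_denom d b c n.

(** At [n = 1] the first denominator may be zero; [cubic a b 0 = 0] then makes
    the quotient vanish as well. *)
Definition rec_alpha d a b c n : R :=
  cubic a b n%:R / rec_denom d b c n *
  (cubic a b (n%:R - 1) / (2 * (rec_denom d b c n - 1)) -
   cubic a b n%:R / rec_denom d b c n +
   cubic a b (n%:R + 1) / (2 * (rec_denom d b c n + 1))).

Definition rec_gamma d a b c n : R :=
  let g := rec_denom d b c n in
  let e := ((n + d)./2)%:R in
  cubic a b n%:R * cubic a b (n%:R + 1) / (g * (g + 1) * (g + 2)) *
  (if odd (n + d) then 1
   else (c + e) * (c + b - a + e) * (c + b + e) / ((g - 1) * g * (g + 1))).

Definition hyp_seq d a b c n := hyp_poly a b (c + b + 1 + ((n + d)./2)%:R) n.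

Definition rec_remainder P (be al ga : nat -> R) n : {poly R} :=
  'X * P n - P n.+1 - be n *: P n - al n *: back P 1 n - ga n.-1 *: back P 2 n.

Lemma third_order_recurrenceP P be al ga :
  (forall n, rec_remainder P be al ga n = 0) -> third_order_recurrence P be al ga.
Proof.
move=> H n; apply/eqP; rewrite -subr_eq0 -oppr_eq0; apply/eqP.
rewrite -[RHS](H n) /rec_remainder mulrBl mul_polyC; ring.
Qed.

(** Vanishing of the coefficient of degree [n - 2] in the recurrence remainder,
    for [x = n] and [g] the denominator at [n].  When [n + d] is even, the
    parameters [f] of the four polynomials of degrees [n+1], [n], [n-1], [n-2]
    are [f], [f], [f-1], [f-1]; when it is odd they are [f+1], [f], [f], [f-1]
    ([contiguous_odd]).  The common factor [u x * u (x - 1)] is removed before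
    normalizing, which keeps the degrees small. *)
Lemma contiguous_even a b x g (u := cubic a b) :
  g != 0 -> g - 1 != 0 -> g + 1 != 0 -> g - 2 != 0 ->
  - (u x * u (x - 1) * u (x - 2) / (6 * g * (g - 1) * (g - 2))) +
  u (x + 1) * u x * u (x - 1) / (6 * (g + 1) * g * (g - 1)) -
  (u (x + 1) / (g + 1) - u x / g) * (u x * u (x - 1) / (2 * g * (g - 1))) +
  u x / g * (u (x - 1) / (2 * (g - 1)) - u x / g + u (x + 1) / (2 * (g + 1))) *
    (u (x - 1) / (g - 2)) =
  u (x - 1) * u x / ((g - 2) * (g - 1) * g).
Proof.
move=> g0 g1 g2 g3.
suff E : - (u (x - 2) / (6 * g * (g - 1) * (g - 2))) +
  u (x + 1)  / (6 * (g + 1) * g * (g - 1)) -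
  (u (x + 1) / (g + 1) - u x / g) * (1 / (2 * g * (g - 1))) +
  (1 / g * (u (x - 1) / (2 * (g - 1)) - u x / g + u (x + 1) / (2 * (g + 1)))) / (g - 2)
   = 1 / ((g - 2) * (g - 1) * g).
  transitivity (u (x - 1) * u x * (1 / ((g - 2) * (g - 1) * g))); last by rewrite mulrA mulr1.
  rewrite -E; move: (u _) (u (x - 1)) (u (x -2)) (u x) => u3 u1 u0 u2.
  by ring.
rewrite /u /cubic; field.
by rewrite g0 g1 g2 g3.
Qed.

Lemma contiguous_odd a b x g (u := cubic a b) :
  g != 0 -> g - 1 != 0 -> g + 1 != 0 -> g - 2 != 0 -> g + 2 != 0 ->
  - (u x * u (x - 1) * u (x - 2) / (6 * g * (g - 1) * (g - 2))) +
  u (x + 1) * u x * u (x - 1) / (6 * (g + 2) * (g + 1) * g) -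
  (u (x + 1) / (g + 2) - u x / g) * (u x * u (x - 1) / (2 * g * (g - 1))) +
  u x / g * (u (x - 1) / (2 * (g - 1)) - u x / g + u (x + 1) / (2 * (g + 1))) *
    (u (x - 1) / (g - 1)) =
  u (x - 1) * u x / ((g - 1) * g * (g + 1)) *
   ((g - x - b) * (g - x - a) * (g - x) / ((g - 2) * (g - 1) * g)).
Proof.
move=> g0 g1 g2 g3 g4.
suff E : - (u (x - 2) / (6 * g * (g - 1) * (g - 2))) +
  u (x + 1)  / (6 * (g + 2) * (g + 1) * g) -
  (u (x + 1) / (g + 2) - u x / g) * (1 / (2 * g * (g - 1))) +
  (1 / g * (u (x - 1) / (2 * (g - 1)) - u x / g + u (x + 1) / (2 * (g + 1)))) / (g - 1)
   = 1 / ((g - 1) * g * (g + 1)) *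
     ((g - x - b) * (g - x - a) * (g - x) / ((g - 2) * (g - 1) * g)).
  transitivity (u (x - 1) * u x * (1 / ((g - 1) * g * (g + 1)) *
    ((g - x - b) * (g - x - a) * (g - x) / ((g - 2) * (g - 1) * g)))); last first.
    by rewrite mul1r !mulrA.
  rewrite -E; move: (u _) (u (x - 1)) (u (x -2)) (u x) => u3 u1 u0 u2.
  by ring.
rewrite /u /cubic; field.
by rewrite g0 g1 g2 g3 g4.
Qed.

Variables (a b c : R) (d : nat).
Hypotheses (C0 : 0 < c + b + 1) (d1 : (d <= 1)%N).
Let Q := hyp_seq d a b c.
Let r := rec_remainder Q (rec_beta d a b c) (rec_alpha d a b c) (rec_gamma d a b c).

Let f0 n : 0 < c + b + 1 + ((n + d)./2)%:R.
Proof. by rewrite ltr_wpDr. Qed.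

Let half_succ n : ((n.+1 + d)./2)%:R = ((n + d)./2)%:R + (odd (n + d))%:R :> R.
Proof. by rewrite addSn -[_.+1./2]/(uphalf _) uphalf_half natrD addrC. Qed.

Let size_back j n : (size (back Q j n) <= n.+1 - j)%N.
Proof.
rewrite /back; case: (leqP j n) => jn; last by rewrite size_poly0.
by rewrite (leq_trans (size_hyp_poly_le _ _ _ _))// subSn.
Qed.

Let coef_back j n i : (n < i + j)%N -> (back Q j n)`_i = 0.
Proof. by move=> nij; rewrite nth_default// (leq_trans (size_back _ _))//; lia. Qed.

Let rec_coef n i : (r n)`_i = ('X * Q n)`_i - (Q n.+1)`_i - rec_beta d a b c n * (Q n)`_i
  - rec_alpha d a b c n * (back Q 1 n)`_i - rec_gamma d a b c n.-1 * (back Q 2 n)`_i.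
Proof. by rewrite !coefB !coefZ. Qed.

Lemma rec_coef_top n i : (n < i)%N -> (r n)`_i = 0.
Proof.
move=> ni; rewrite rec_coef !coef_back ?ltn_addr// !mulr0 !subr0.
have Qi : (Q n)`_i = 0 by rewrite nth_default// (leq_trans (size_hyp_poly_le _ _ _ _)).
rewrite Qi mulr0 subr0; case: i ni {Qi} => // i; rewrite ltnS leq_eqVlt => /predU1P[<-|ni].
  by rewrite coefXM/= !hyp_poly_lead subrr.
by rewrite coefXM/= !nth_default ?subrr// (leq_trans (size_hyp_poly_le _ _ _ _)).
Qed.

(** The coefficient of degree [n] determines [rec_beta]; the two lower ones,
    treated in [rec_coef1] and [rec_coef2], determine [rec_alpha] and
    [rec_gamma]. *)
Lemma rec_coef0 n : (r n)`_n = 0.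
Proof.
rewrite rec_coef !coef_back ?addnS ?ltnS ?addn0 ?leqnSn// !mulr0 !subr0.
rewrite hyp_polyXM_coef0 hyp_poly_coef1 hyp_poly_lead mulr1 half_succ.
rewrite /rec_beta /rec_denom -natr1.
set o := (odd _)%:R; set e := (_./2)%:R.
have -> : c + b + 1 + (e + o) + n%:R = c + b + n%:R + e + 1 + o by ring.
have -> : c + b + 1 + e + n%:R - 1 = c + b + n%:R + e by ring.
ring.
Qed.

Let back1 n : back Q 1 n.+1 = Q n.
Proof. by rewrite /back subSS subn0. Qed.

Let back2 n : back Q 2 n.+2 = Q n.
Proof. by rewrite /back !subSS subn0. Qed.

Let rec_denom_pred n : c + b + 1 + ((n.+1 + d)./2)%:R + n%:R = rec_denom d b c n.+1.
Proof. by rewrite /rec_denom -natr1; ring. Qed.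

Lemma rec_coef1 n : (r n.+1)`_n = 0.
Proof.
rewrite rec_coef [(back Q 2 _)`__]coef_back ?addnS ?ltnS ?addn0// !mulr0 !subr0.
rewrite hyp_polyXM_coef1// hyp_poly_coef2// hyp_poly_coef1.
rewrite back1 hyp_poly_lead mulr1 (half_succ n.+1).
rewrite /rec_beta /rec_alpha rec_denom_pred.
set g := rec_denom _ _ _ _; set o := (odd _)%:R.
have g0 : 0 < g by rewrite /g -rec_denom_pred ltr_wpDr.
have hE x : c + b + 1 + (((n.+1 + d)./2)%:R + o) + x = g + o + (x - n%:R).
  by rewrite /g -rec_denom_pred; ring.
have n1 : n.+1%:R = n%:R + 1 :> R by rewrite natr1.
have n2 : n.+2%:R = n%:R + 1 + 1 :> R by rewrite !natr1.
rewrite !hE subrr addr0 n2 n1 addrK [_ + 1 - n%:R]addrC addKr.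
move: (cubic a b _) (cubic a b _) (cubic a b _) => u2 u1 u0.
have gN : g != 0 by rewrite gt_eqF.
have gN1 : g + 1 != 0 by rewrite gt_eqF// addr_gt0.
have gN2 : g + 1 + 1 != 0 by apply: lt0r_neq0; lra.
(* [g - 1] may be zero here (n = 0), so its inverse is kept as an atom. *)
rewrite !invfM; move: (g - 1)^-1 => w.
by rewrite /o; case: (odd _) => /=; field; rewrite ?gN ?gN1 ?gN2.
Qed.

Lemma rec_coef2 n : (r n.+2)`_n = 0.
Proof.
have n1 : n.+1%:R = n.+2%:R - 1 :> R by rewrite -[n.+2%:R]natr1 addrK.
have n2 : n%:R = n.+2%:R - 2 :> R by rewrite -[n.+2%:R]natr1 -[n.+1%:R]natr1; ring.
have n3 : n.+3%:R = n.+2%:R + 1 :> R by rewrite natr1.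
rewrite rec_coef back1 back2 hyp_polyXM_coef2// hyp_poly_coef3//.
rewrite hyp_poly_coef2// hyp_poly_coef1 hyp_poly_lead mulr1.
rewrite (half_succ n.+2) /rec_beta /rec_alpha /rec_gamma -[n.+2.-1]/n.+1.
have oE : odd (n.+2 + d) = ~~ odd (n.+1 + d) by rewrite addSn.
have eE := half_succ n.+1.
set g := rec_denom d b c n.+2.
have g3 : 0 < g - 2.
  have -> : g - 2 = c + b + 1 + ((n + d)./2)%:R + n%:R.
    rewrite /g /rec_denom n2 -[(n.+2 + d)./2]/((n + d)./2.+1) -[((n + d)./2.+1)%:R]natr1; ring.
  by rewrite ltr_wpDr.
have gE : g = c + b + n.+2%:R + (((n.+1 + d)./2)%:R + (odd (n.+1 + d))%:R) by rewrite -eE.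
have -> : rec_denom d b c n.+1 = g - 1 - (odd (n.+1 + d))%:R by rewrite gE /rec_denom n1; ring.
rewrite oE n3 n2 n1 eE; clearbody g.
move: (n.+2%:R : R) gE => x.
move: (((n.+1 + d)./2)%:R : R) => e gE.
(* The identity is free of [c] once everything is expressed through [g]. *)
have cE : c = g - b - x - e - (odd (n.+1 + d))%:R by rewrite gE; ring.
rewrite cE.
have gN k : k \in [:: 0; 1; 2; -1; -2] -> g + k != 0.
  by rewrite !inE => kI; apply: lt0r_neq0; move: kI => /or4P[|||/orP[]] /eqP ->; lra.
have h1 : g != 0 by rewrite -[g]addr0 gN ?inE ?eqxx.
have [h2 h3 h4 h5] : [/\ g + 1 != 0, g + 2 != 0, g - 1 != 0 & g - 2 != 0].
  by rewrite !gN ?inE ?eqxx ?orbT.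
case: (odd (n.+1 + d)) => /=; rewrite !(addr0, subr0) [x - 1 + 1]subrK.
- have /eqP := @contiguous_even a b x g h1 h4 h2 h5.
  rewrite -subr_eq0 => /eqP <-.
  rewrite (_ : _ + (e + 1) + (x - 1) = g); last by ring.
  rewrite (_ : _ + (e + 1) + (x - 2) = g - 1); last by ring.
  rewrite (_ : _ + (e + 1) + x = g + 1); last by ring.
  rewrite (_ : _ + e + (x - 2) = g - 2); last by ring.
  rewrite (_ : g - 1 - 1 = g - 2); last by ring.
  rewrite (_ : g - 2 + 1 = g - 1); last by ring.
  by rewrite subrK mulr1 opprK mulrN opprK.
- have /eqP := @contiguous_odd a b x g h1 h4 h2 h5 h3.
  rewrite -subr_eq0 => /eqP <-.
  rewrite (_ : _ + (e + 1) + (x - 1) = g + 1); last by ring.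
  rewrite (_ : _ + (e + 1) + (x - 2) = g); last by ring.
  rewrite (_ : _ + (e + 1) + x = g + 2); last by ring.
  rewrite (_ : _ + e + (x - 2) = g - 1); last by ring.
  rewrite (_ : _ + e + (x - 1) = g); last by ring.
  rewrite (_ : g - b - x - e + e = g - x - b); last by ring.
  rewrite (_ : g - b - x - e + b - a + e = g - x - a); last by ring.
  rewrite (_ : g - b - x - e + b + e = g - x); last by ring.
  rewrite (_ : g - 1 - 1 = g - 2); last by ring.
  rewrite (_ : g - 1 + 2 = g + 1); last by ring.
  rewrite (_ : g + 1 + 1 = g + 2); last by ring.
  by rewrite subrK opprK mulrN opprK.
Qed.

Lemma hyp_seq_recurrence_coef n i : (n <= i.+2)%N -> (r n)`_i = 0.
Proof.
case: (ltnP n i) => [/rec_coef_top//|]; rewrite leq_eqVlt => /predU1P[->|].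
  by rewrite rec_coef0.
rewrite leq_eqVlt => /predU1P[<-|]; first by rewrite rec_coef1.
by move=> i2 n2; have -> : n = i.+2 by [lia]; rewrite rec_coef2.
Qed.

Lemma size_rec_remainder n : (size (r n) <= n - 2)%N.
Proof. by apply/leq_sizeP => j nj; apply: hyp_seq_recurrence_coef; lia. Qed.

End Recurrence.

(** * Uniqueness and the recurrence of 2-orthogonal sequences *)

Section StepLine.
Variable R : realType.
Variables (a b c : R) (d : nat) (P : nat -> {poly R}).
Hypotheses (C0 : 0 < c + b + 1) (d1 : (d <= 1)%N).

(** The functionals [p |-> L_i (x^k p)], for the two weights [i = 0, 1],
    enumerated by [j = 2k + i]. *)
Definition stepline_functional j : {scalar {poly R}} :=
  moment_form (moment_seq a b (c + b + 1 + (if odd j then (1 - d)%N else d)%:R)) j./2.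

(** Relative to the weight with denominator [C + t], where [t] is 0 or 1, the
    parameter [C + e] is raised by [e - t] steps, and orthogonality needs
    [k <= e - t] and [e - t + k < n]; the value [e = floor((n+d)/2)] satisfies
    both for every [j < n], whatever the parity of [j] and the value of [d]. *)
Lemma hyp_seq_orthogonal j n : (j < n)%N -> stepline_functional j (hyp_seq d a b c n) = 0.
Proof.
move=> jn; rewrite /stepline_functional /hyp_seq.
set C := c + b + 1; set t := if _ then _ else _; set e := ((n + d)./2)%N.
have tle : (t <= 1)%N by rewrite /t; case: ifP; lia.
have [te ke kn] : [/\ (t <= e)%N, (j./2 <= e - t)%N & (e - t + j./2 < n)%N].
  by move: d1 jn; rewrite /t /e; case: (boolP (odd j)); case: d => [|[|//]] => *; split; lia.
rewrite (_ : C + e%:R = C + t%:R + (e - t)%:R); last first.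
  by rewrite -[RHS]addrA -natrD subnKC.
by apply: hyp_poly_orthogonal => //; rewrite ltr_wpDr.
Qed.

Hypothesis sizeP : forall n, size (P n) = n.+1.
Hypothesis mcP : forall n, P n \is monic.
Hypothesis killP : forall j n, (j < n)%N -> stepline_functional j (P n) = 0.
Hypothesis dualP : forall j, stepline_functional j (P j) != 0.

Lemma two_orthogonal_eq_hyp_seq n : P n = hyp_seq d a b c n.
Proof.
apply/eqP; rewrite -subr_eq0; apply/eqP.
apply: (@killed_by_dual_eq0 _ P sizeP stepline_functional n) => //.
- apply/leq_sizeP => j; rewrite leq_eqVlt coefB => /predU1P[<-|nj].
    rewrite hyp_poly_lead; move/monicP: (mcP n).
    by rewrite lead_coefE sizeP => ->; rewrite subrr.
  by rewrite !nth_default ?subrr ?sizeP// (leq_trans (size_hyp_poly_le _ _ _ _)).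
- by move=> j jn; rewrite /stepline_functional linearB /= killP// hyp_seq_orthogonal// subrr.
Qed.

(** Multiplication by ['X] turns the functional [j] into the functional
    [j + 2], so the remainder is annihilated by the functionals [j < n - 2],
    and its degree is less than [n - 2]. *)
Lemma two_orthogonal_recurrence :
  third_order_recurrence P (rec_beta d a b c) (rec_alpha d a b c) (rec_gamma d a b c).
Proof.
have -> : P = hyp_seq d a b c by apply/funext => n; exact: two_orthogonal_eq_hyp_seq.
apply: third_order_recurrenceP => n.
apply: (@killed_by_dual_eq0 _ P sizeP stepline_functional (n - 2)) => //.
  exact: size_rec_remainder.
move=> j jn; have jn2 : (j.+2 < n)%N by lia.
have backj i : (i <= 2)%N -> stepline_functional j (back (hyp_seq d a b c) i n) = 0.
  by move=> i2; rewrite /back; case: ifP => _; rewrite ?linear0// hyp_seq_orthogonal//; lia.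
rewrite /rec_remainder !linearB !linearZ /= !backj// !hyp_seq_orthogonal ?mulr0 ?subr0; try lia.
have := @hyp_seq_orthogonal j.+2 n jn2; rewrite /stepline_functional /= negbK.
rewrite moment_formXM => ->.
by rewrite oppr0 !scaler0 !addr0.
Qed.

End StepLine.

(** * Integration over the half-line *)

Section HalfLine.
Variable R : realType.
Local Notation mu := (@lebesgue_measure R).
Local Notation D := (`]0%R, +oo[%classic : set R).
Implicit Types (s x t z : R).

(** A measure is determined by its values on bounded intervals. *)
Lemma lebesgue_measure_scale s (s0 : 0 < s) (A : set R) : measurable A ->
  (s%:E * mu (( *%R s) @^-1` A) = mu A)%E.
Proof.
move=> mA.
have ms : @measurable_fun _ _ (measurableTypeR R) (measurableTypeR R) setT ( *%R s).
  exact: mulrl_measurable.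
pose phi : measurableTypeR R -> measurableTypeR R := *%R s.
pose m' : {measure set (measurableTypeR R) -> \bar R} :=
  mscale (NngNum (ltW s0)) (pushforward mu phi).
pose m := m' ms.
rewrite -[LHS]/(m A); apply/esym/(@lebesgue_measure_unique _ m) => //.
move=> _ [[a b] _ <-].
rewrite -[RHS]/(s%:E * mu (phi @^-1` `]a, b]%classic))%E.
rewrite (_ : _ @^-1` _ = `]a / s, b / s]%classic); last first.
  by apply/seteqP; split => x /=; rewrite !in_itv /= ltr_pdivrMr// ler_pdivlMr// mulrC.
rewrite !lebesgue_measure_itv /= !lte_fin ltr_pM2r ?invr_gt0//.
case: ifP => _; last by rewrite mule0.
by rewrite -!EFinD -EFinM; congr EFin; field; rewrite gt_eqF.
Qed.

(** Change of variable [x := s * x].  Going through the image measure requires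
    only measurability of [h], which matters for integrands that are singular
    at 0. *)
Lemma integral_halfline_scale s (h : R -> R) : 0 < s -> measurable_fun [set: R] h ->
  (forall x, 0 <= h x) ->
  (\int[mu]_(x in D) (h x)%:E = s%:E * \int[mu]_(x in D) (h (s * x))%:E)%E.
Proof.
move=> s0 mh h0.
have ms : @measurable_fun _ _ (measurableTypeR R) (measurableTypeR R) setT ( *%R s).
  exact: mulrl_measurable.
pose phi : measurableTypeR R -> measurableTypeR R := *%R s.
pose m' : {measure set (measurableTypeR R) -> \bar R} :=
  mscale (NngNum (ltW s0)) (pushforward mu phi).
pose m := m' ms.
have mhD : measurable_fun D (EFin \o h).
  by apply/measurable_EFinP; exact: measurable_funTS.
transitivity (\int[m]_(x in D) (h x)%:E)%E.
  by apply: eq_measure_integral => A mA _; exact/esym/lebesgue_measure_scale.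
rewrite ge0_integral_mscale//; last by move=> x _; rewrite lee_fin.
congr (_ * _)%E; rewrite ge0_integral_pushforward//; last by move=> x _; rewrite lee_fin.
rewrite (_ : phi @^-1` D = D)//.
by apply/seteqP; split => x /=; rewrite !in_itv /= !andbT pmulr_rgt0.
Qed.

Section Tonelli.
Variable k : R -> R -> R.
Hypothesis mk : measurable_fun [set: R * R] (fun p => k p.1 p.2).
Hypothesis k0 : forall x y, 0 <= k x y.

Let K (p : R * R) : \bar R := ((fun p => (k p.1 p.2)%:E) \_ (D `*` D)) p.

Let mK : measurable_fun setT K.
Proof.
apply/(measurable_restrictT _ _).1; first exact: measurableX.
by apply/measurable_EFinP; exact: measurable_funTS.
Qed.

Let K0 p : (0 <= K p)%E.
Proof. by apply: erestrict_ge0 => q _; rewrite lee_fin. Qed.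

Let intK x : (\int[mu]_y K (x, y) = ((fun x => \int[mu]_(y in D) (k x y)%:E) \_ D) x)%E.
Proof.
rewrite patchE; case: ifPn => xD.
  rewrite [RHS]integral_mkcond; apply: eq_integral => y _.
  rewrite /K !patchE; congr (if _ then _ else _).
  by apply/idP/idP; rewrite !inE /=; [case|split=> //; move: xD; rewrite inE].
rewrite integral0_eq// => y _; rewrite /K patchE ifN//.
by apply: contra xD; rewrite !inE /= => -[].
Qed.

Lemma measurable_halfline_integral :
  measurable_fun D (fun x => \int[mu]_(y in D) (k x y)%:E)%E.
Proof.
apply/(measurable_restrictT _ _).2 => //.
rewrite (_ : _ \_ _ = (fun x => \int[mu]_y K (x, y))%E).
  exact: (measurable_fun_fubini_tonelli_F (m2 := mu) K).
by apply/funext => x; rewrite intK.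
Qed.

Let intK' y : (\int[mu]_x K (x, y) = ((fun y => \int[mu]_(x in D) (k x y)%:E) \_ D) y)%E.
Proof.
rewrite patchE; case: ifPn => yD.
  rewrite [RHS]integral_mkcond; apply: eq_integral => x _.
  rewrite /K !patchE; congr (if _ then _ else _).
  by apply/idP/idP; rewrite !inE /=; [case|split=> //; move: yD; rewrite inE].
rewrite integral0_eq// => x _; rewrite /K patchE ifN//.
by apply: contra yD; rewrite !inE /= => -[].
Qed.

Lemma tonelli_halfline :
  (\int[mu]_(x in D) \int[mu]_(y in D) (k x y)%:E =
   \int[mu]_(y in D) \int[mu]_(x in D) (k x y)%:E)%E.
Proof.
rewrite integral_mkcond [RHS]integral_mkcond.
under eq_integral do rewrite -intK; under [RHS]eq_integral do rewrite -intK'.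
exact: (fubini_tonelli (m1 := mu) (m2 := mu) K).
Qed.

End Tonelli.

(** The Gamma integral with values in the extended reals: identities can be
    proved before finiteness is known, and finiteness deduced from them. *)
Definition eGamma z : \bar R := (\int[mu]_(x in D) (x `^ (z - 1) * expR (- x))%:E)%E.

Lemma measurable_powR_comp (d : measure_display) (T : measurableType d) (f : T -> R) p :
  measurable_fun setT f -> measurable_fun setT (fun u => f u `^ p).
Proof. by move=> mf; exact: (measurableT_comp (measurable_powR p)). Qed.

Lemma measurable_expR_comp (d : measure_display) (T : measurableType d) (f : T -> R) :
  measurable_fun setT f -> measurable_fun setT (fun u => expR (f u)).
Proof. by move=> mf; exact: (measurableT_comp (@measurable_expR R)). Qed.

Lemma gamma_integrand_ge0 z x : 0 <= x `^ (z - 1) * expR (- x).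
Proof. by rewrite mulr_ge0 ?powR_ge0 ?expR_ge0. Qed.

Lemma measurable_gamma_integrand z :
  measurable_fun [set: R] (fun x => x `^ (z - 1) * expR (- x)).
Proof.
apply: measurable_funM; first exact: measurable_powR_comp.
by apply: measurable_expR_comp; exact: oppr_measurable.
Qed.

Lemma measurable_EFin_gamma_integrand z :
  measurable_fun D (fun x => (x `^ (z - 1) * expR (- x))%:E).
Proof.
apply/measurable_EFinP; apply: measurable_funTS.
exact: measurable_gamma_integrand.
Qed.

Lemma eGamma_ge0 z : (0 <= eGamma z)%E.
Proof. by apply: integral_ge0 => x _; rewrite lee_fin gamma_integrand_ge0. Qed.

(** The Laplace transform of a power. *)
Lemma eGamma_laplace z s : 0 < s ->
  (\int[mu]_(x in D) (x `^ (z - 1) * expR (- (x * s)))%:E = (s `^ (- z))%:E * eGamma z)%E.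
Proof.
move=> s0; pose h x := x `^ (z - 1) * expR (- x).
have h0 x : 0 <= h x by exact: gamma_integrand_ge0.
have mh : measurable_fun [set: R] h by exact: measurable_gamma_integrand.
rewrite /eGamma (integral_halfline_scale s0 mh h0) muleA -EFinM.
rewrite -ge0_integralZl//; last 3 first.
- apply/measurable_EFinP/measurable_funTS/(measurableT_comp mh).
  exact: mulrl_measurable.
- by move=> x _; rewrite lee_fin.
- by rewrite lee_fin mulr_ge0 ?powR_ge0 ?ltW.
apply: eq_integral => x; rewrite inE /= in_itv /= andbT => x0.
rewrite -EFinM /h powRM ?(ltW s0) ?(ltW x0)// [s * x]mulrC mulrA; congr (_ * _)%:E.
rewrite -[LHS]mul1r mulrA; congr (_ * _).
rewrite -{2}[s]powRr1 ?(ltW s0)// -!powRD ?(gt_eqF s0) ?implybT//.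
by rewrite (_ : - z + 1 + (z - 1) = 0) ?powRr0//; ring.
Qed.

(** The key interchange: both sides are the double integral of
    [g t * x^(z-1) * exp(-x(t+1))], integrated over [x] first on the left and
    over [t] first on the right.  It yields the Beta integral for
    [g t = t^(p-1)], and the moments of the weight when [g] is the integrand
    of the Tricomi function. *)
Lemma laplace_mellin_gamma (g : R -> R) z : measurable_fun [set: R] g -> (forall t, 0 <= g t) ->
  (eGamma z * \int[mu]_(t in D) (g t * (t + 1) `^ (- z))%:E =
   \int[mu]_(x in D) ((x `^ (z - 1) * expR (- x))%:E *
      \int[mu]_(t in D) (g t * expR (- (t * x)))%:E))%E.
Proof.
move=> mg g0.
pose k x t := x `^ (z - 1) * expR (- x) * (g t * expR (- (t * x))).
have k0 x t : 0 <= k x t by rewrite !mulr_ge0 ?powR_ge0 ?expR_ge0.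
have mk : measurable_fun [set: R * R] (fun p => k p.1 p.2).
  do 2?apply: measurable_funM.
  - exact: measurable_powR_comp.
  - by apply: measurable_expR_comp; exact: measurable_funN.
  - exact: measurableT_comp.
  - by apply: measurable_expR_comp; apply: measurable_funN; exact: measurable_funM.
transitivity (\int[mu]_(t in D) \int[mu]_(x in D) (k x t)%:E)%E.
  rewrite -ge0_integralZl//; last 3 first.
  - apply/measurable_EFinP/measurable_funTS/measurable_funM => //.
    by apply: measurable_powR_comp; exact: measurable_funD.
  - by move=> t _; rewrite lee_fin mulr_ge0 ?powR_ge0.
  - exact: eGamma_ge0.
  apply: eq_integral => t; rewrite inE /= in_itv /= andbT => t0.
  rewrite EFinM muleCA [(eGamma z * _)%E]muleC -eGamma_laplace ?addr_gt0//.
  rewrite -ge0_integralZl//; last 3 first.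
  - apply/measurable_EFinP/measurable_funTS/measurable_funM; first exact: measurable_powR_comp.
    by apply: measurable_expR_comp; apply: measurable_funN; exact: mulrr_measurable.
  - by move=> x _; rewrite lee_fin mulr_ge0 ?powR_ge0 ?expR_ge0.
  - by rewrite lee_fin.
  apply: eq_integral => x _; rewrite -EFinM /k; congr EFin.
  have -> : - (x * (t + 1)) = - x + - (t * x) by ring.
  by rewrite expRD; ring.
rewrite -tonelli_halfline//; apply: eq_integral => x _.
rewrite -ge0_integralZl//.
- apply/measurable_EFinP/measurable_funTS/measurable_funM => //.
  by apply: measurable_expR_comp; apply: measurable_funN; exact: mulrr_measurable.
- by move=> t _; rewrite lee_fin mulr_ge0 ?expR_ge0.
- by rewrite lee_fin mulr_ge0 ?powR_ge0 ?expR_ge0.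
Qed.

End HalfLine.

(** * Gamma and Beta functions *)

Section GammaBeta.
Variable R : realType.
Local Notation mu := (@lebesgue_measure R).
Local Notation D := (`]0%R, +oo[%classic : set R).
Implicit Types (s x t z p q : R).

Lemma powRN_cvg0 z : 0 < z -> (t + 1) `^ (- z) @[t --> +oo%R] --> (0 : R).
Proof.
move=> z0; apply/cvgrPdist_lt => e e0; near=> t.
have t0 : 0 < t by near: t; apply: nbhs_pinfty_gt; exact: num_real.
have te : (e^-1) `^ (z^-1) < t by near: t; apply: nbhs_pinfty_gt; exact: num_real.
have t1 : 0 < t + 1 by rewrite addr_gt0.
rewrite sub0r normrN ger0_norm ?powR_ge0// powRN invf_plt ?posrE ?powR_gt0//.
have -> : e^-1 = (e^-1 `^ z^-1) `^ z.
  by rewrite -powRrM mulVf ?lt0r_neq0// powRr1// invr_ge0 ltW.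
apply: gt0_ltr_powR => //; rewrite ?nnegrE ?powR_ge0 ?(ltW t1)//.
by rewrite (lt_trans te)// ltrDl.
Unshelve. all: by end_near. Qed.

Lemma is_derive_powR_shift p t : 0 < t + 1 ->
  is_derive t 1 (fun t => (t + 1) `^ p) (p * (t + 1) `^ (p - 1)).
Proof.
move=> t1.
have H := @is_derive1_powR R p (t + 1) t1.
have -> : p * (t + 1) `^ (p - 1) = p * (t + 1) `^ (p - 1) * 1 by rewrite mulr1.
have K : is_derive t 1 (fun t : R => t + 1) 1.
  by apply: is_derive_eq; rewrite addr0.
exact: (@is_derive1_comp _ (powR (R:=R) ^~ p) (fun t : R => t + 1) t _ _ H K).
Qed.

Lemma integral_powR_shift z : 0 < z ->
  (\int[mu]_(t in D) ((t + 1) `^ (- (z + 1)))%:E = (z^-1)%:E)%E.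
Proof.
move=> z0; have zN : z != 0 by rewrite lt0r_neq0.
have mf : measurable_fun D (EFin \o (fun t : R => (t + 1) `^ (- (z + 1)))).
  apply/measurable_EFinP/measurable_funTS/measurable_powR_comp.
  exact: measurable_funD.
rewrite integral_itv_obnd_cbnd//.
pose F t : R := - z^-1 * (t + 1) `^ (- z).
have dF t : 0 <= t -> is_derive t 1 F ((t + 1) `^ (- (z + 1))).
  move=> t0; have t1 : 0 < t + 1 by rewrite ltr_wpDl.
  have H := is_derive_powR_shift (- z) t1.
  apply: is_derive_eq; rewrite /GRing.scale /= mulrA mulrNN mulVf// mul1r.
  by congr (_ `^ _); ring.
rewrite (@ge0_continuous_FTC2y _ _ F 0 0) //.
- by rewrite -EFinB /F sub0r add0r powR1 mulr1 opprK.
- by move=> x _; exact: powR_ge0.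
- apply: derivable_within_continuous => t; rewrite in_itv /= andbT => t0.
  have t1 : 0 < t + 1 by rewrite ltr_wpDl.
  by have [] := is_derive_powR_shift (- (z + 1)) t1.
- rewrite -(mulr0 (- z^-1)); apply: cvgM; first exact: cvg_cst.
  exact: powRN_cvg0.
- by move=> t t0; have [] := dF t (ltW t0).
- apply: cvg_at_right_filter.
  have [/derivable1_diffP dF0 _] := dF 0 (lexx 0).
  exact: differentiable_continuous.
- move=> t; rewrite in_itv /= andbT => /ltW t0.
  by have [_ dE] := dF t t0; rewrite derive1E dE.
Qed.

Lemma eGamma1 : eGamma (1 : R) = 1%E.
Proof.
rewrite -[RHS](@integral_exponential_pdf R 1)//.
rewrite [RHS](_ : _ = \int[mu]_(x in `[0%R, +oo[) (1 * expR (- 1 * x))%:E)%E; last first.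
  rewrite [RHS]integral_mkcond; apply: eq_integral => x _.
  by rewrite /exponential_pdf !patchE; case: ifP.
rewrite -integral_itv_obnd_cbnd; last first.
  apply/measurable_EFinP/measurable_funTS/measurable_funM => //.
  by apply: measurable_expR_comp; exact: mulrl_measurable.
by apply: eq_integral => x _; rewrite subrr powRr0 mulN1r.
Qed.

Lemma eGamma_beta p q :
  (eGamma (p + q) * \int[mu]_(t in D) (t `^ (p - 1) * (t + 1) `^ (- (p + q)))%:E
   = eGamma p * eGamma q)%E.
Proof.
rewrite laplace_mellin_gamma; last 2 first.
- exact: measurable_powR_comp.
- by move=> t; exact: powR_ge0.
rewrite {2}/eGamma -[RHS]ge0_integralZl; last 4 first.
- exact: measurable_itv.
- exact: measurable_EFin_gamma_integrand.
- by move=> x _; rewrite lee_fin gamma_integrand_ge0.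
- exact: eGamma_ge0.
apply: eq_integral => x; rewrite inE /= in_itv /= andbT => x0.
rewrite eGamma_laplace// muleA -EFinM muleC; congr (_ * _%:E)%E.
rewrite mulrAC -powRD ?(gt_eqF x0) ?implybT//.
by rewrite (_ : p + q - 1 + - p = q - 1)//; ring.
Qed.

(** The case [p = 1] of the Beta identity: the Beta integral is then elementary.
    This replaces integration by parts, whose boundary terms and sign changes
    would need care on the half-line. *)
Lemma eGammaD1 z : 0 < z -> (eGamma (z + 1) = z%:E * eGamma z)%E.
Proof.
move=> z0; have := eGamma_beta 1 z; rewrite eGamma1 mul1e => <-.
under eq_integral do rewrite subrr powRr0 mul1r [1 + z]addrC.
rewrite integral_powR_shift// [1 + z]addrC muleCA -EFinM mulfV ?mule1//.
by rewrite lt0r_neq0.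
Qed.

Lemma eGamma_nat n : (eGamma (n.+1%:R : R) < +oo)%E.
Proof.
elim: n => [|n IH]; first by rewrite eGamma1 ltry.
by rewrite -natr1 eGammaD1// lte_mul_pinfty.
Qed.

(** Comparison with integers: [x^z <= 1 + x^n] for [z <= n], so the value at
    [z + 1] is finite, and the functional equation brings this down to [z]. *)
Lemma eGamma_lty z : 0 < z -> (eGamma z < +oo)%E.
Proof.
move=> z0.
suff : (eGamma (z + 1) < +oo)%E.
  rewrite eGammaD1//; case: (eGamma z) (eGamma_ge0 z) => [r| |//] _.
    by move=> _; exact: ltry.
  by rewrite gt0_muley ?lte_fin.
have [n zn] : exists n : nat, z <= n%:R.
  by exists (Num.bound z); rewrite ltW// archi_boundP// ltW.
apply: (@le_lt_trans _ _ (eGamma 1 + eGamma n.+1%:R)%E); last first.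
  by apply: lte_add_pinfty; [rewrite eGamma1; exact: ltry | exact: eGamma_nat].
have mG := measurable_EFin_gamma_integrand.
have G0 := @gamma_integrand_ge0 R.
rewrite -ge0_integralD; last 5 first.
- exact: measurable_itv.
- by move=> x _; rewrite lee_fin.
- exact: mG.
- by move=> x _; rewrite lee_fin.
- exact: mG.
apply: ge0_le_integral; first exact: measurable_itv.
- by move=> x _; rewrite lee_fin.
- exact: mG.
- by apply: emeasurable_funD; exact: mG.
move=> x; rewrite /= in_itv /= andbT => x0.
rewrite -EFinD lee_fin -mulrDl ler_wpM2r ?expR_ge0// addrK subrr powRr0.
rewrite -[n.+1%:R]natr1 addrK.
have [x1|x1] := leP x 1.
  rewrite (le_trans _ (_ : 1 <= _))//; last by rewrite lerDl powR_ge0.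
  by rewrite -[leRHS](powRr0 x) ger_powR// ?x0// ltW.
by rewrite (le_trans (ler_powR (ltW x1) zn))// lerDr.
Qed.

(** A zero value would make the integrand, hence [exp(-x)], vanish almost
    everywhere. *)
Lemma eGamma_neq0 z : eGamma z != 0%E.
Proof.
apply/eqP => G0.
have mD : measurable D by [].
have [+ _] := ae_eq_integral_abs mu mD (measurable_EFin_gamma_integrand z).
have -> : (\int[mu]_(x in D) `|(x `^ (z - 1) * expR (- x))%:E| = 0)%E.
  rewrite -[RHS]G0; apply: eq_integral => x _.
  by rewrite gee0_abs// lee_fin gamma_integrand_ge0.
move=> /(_ erefl) ae0.
have : (eGamma (1 : R) = 0)%E.
  rewrite /eGamma -[RHS](integral0 mu D).
  apply: ae_eq_integral; first exact: measurable_itv.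
  - exact: measurable_EFin_gamma_integrand.
  - exact: measurable_cst.
  apply: filterS ae0 => x + Dx => /(_ Dx) /=.
  move: Dx; rewrite /= in_itv /= andbT => x0 [/eqP].
  by rewrite mulf_eq0 !gt_eqF ?powR_gt0 ?expR_gt0.
by rewrite eGamma1 => /eqP; rewrite onee_eq0.
Qed.

Lemma GammaE z : 0 < z -> (Gamma z)%:E = eGamma z.
Proof.
move=> z0; rewrite /Gamma /Rintegral fineK// ge0_fin_numE ?eGamma_ge0//.
exact: eGamma_lty.
Qed.

Lemma Gamma_gt0 z : 0 < z -> 0 < Gamma z.
Proof.
move=> z0; rewrite -lte_fin GammaE// lt_neqAle eq_sym eGamma_neq0.
exact: eGamma_ge0.
Qed.

Lemma GammaD1 z : 0 < z -> Gamma (z + 1) = z * Gamma z.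
Proof.
by move=> z0; apply: EFin_inj; rewrite EFinM !GammaE ?addr_gt0// eGammaD1.
Qed.

Lemma Gamma_poch z n : 0 < z -> Gamma (z + n%:R) = poch z n * Gamma z.
Proof.
move=> z0; elim: n => [|n IH]; first by rewrite addr0 /poch big_ord0 mul1r.
rewrite -natr1 addrA GammaD1 ?ltr_wpDr// IH /poch big_ord_recr/=; ring.
Qed.

End GammaBeta.

(** * Moments of the weight *)

Section Moments.
Variable R : realType.
Local Notation mu := (@lebesgue_measure R).
Local Notation D := (`]0%R, +oo[%classic : set R).
Implicit Types (s x t z p q : R).

Lemma beta_integral p q : 0 < p -> 0 < q ->
  (\int[mu]_(t in D) (t `^ (p - 1) * (t + 1) `^ (- (p + q)))%:E =
   (Gamma p * Gamma q / Gamma (p + q))%:E)%E.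
Proof.
move=> p0 q0; have := eGamma_beta p q.
have G0 := Gamma_gt0 (addr_gt0 p0 q0).
rewrite -!GammaE ?addr_gt0// => /(congr1 (fun y => ((Gamma (p + q))^-1%:E * y)%E)).
rewrite muleA -!EFinM mulVf ?gt_eqF// mul1e => ->.
by rewrite mulrC.
Qed.

(** The integrand of the Tricomi function with parameters [c] and [a - b + 1]. *)
Definition laplace_kernel a b c x t : R :=
  t `^ (c - 1) * (t + 1) `^ (a - b + 1 - c - 1) * expR (- (t * x)).

Definition laplace_int a b c x : \bar R := (\int[mu]_(t in D) (laplace_kernel a b c x t)%:E)%E.

Lemma laplace_kernel_ge0 a b c x t : 0 <= laplace_kernel a b c x t.
Proof. by rewrite !mulr_ge0 ?powR_ge0 ?expR_ge0. Qed.

Lemma measurable_laplace_kernel a b c :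
  measurable_fun [set: R * R] (fun u => laplace_kernel a b c u.1 u.2).
Proof.
do 2?apply: measurable_funM.
- exact: measurable_powR_comp.
- by apply: measurable_powR_comp; exact: measurable_funD.
- by apply: measurable_expR_comp; apply: measurable_funN; exact: measurable_funM.
Qed.

(** As [a - b < c], the power of [t + 1] is at most 1, and the Laplace transform
    of [t^(c-1)] is a finite upper bound. *)
Lemma laplace_int_fin_num a b c x : 0 < c -> a - b < c -> 0 < x ->
  laplace_int a b c x \is a fin_num.
Proof.
move=> c0 abc x0; rewrite ge0_fin_numE; last first.
  by apply: integral_ge0 => t _; rewrite lee_fin laplace_kernel_ge0.
apply: (@le_lt_trans _ _ (\int[mu]_(t in D) (t `^ (c - 1) * expR (- (t * x)))%:E)%E).
  apply: ge0_le_integral; first exact: measurable_itv.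
  - by move=> t _; rewrite lee_fin laplace_kernel_ge0.
  - apply/measurable_EFinP/measurable_funTS.
    exact: (measurableT_comp (@measurable_laplace_kernel a b c) (measurable_pair1 x)).
  - apply/measurable_EFinP/measurable_funTS/measurable_funM; first exact: measurable_powR_comp.
    by apply: measurable_expR_comp; apply: measurable_funN; exact: mulrr_measurable.
  - move=> t; rewrite /= in_itv /= andbT => t0; rewrite lee_fin.
    rewrite ler_wpM2r ?expR_ge0// ler_piMr ?powR_ge0//.
    by rewrite -[leRHS](powRr0 (t + 1)) ler_powR//; [rewrite lerDr ltW|lra].
by rewrite eGamma_laplace// -GammaE// -EFinM ltry.
Qed.

Lemma measurable_laplace_int a b c : measurable_fun D (laplace_int a b c).
Proof.
exact: measurable_halfline_integral (@measurable_laplace_kernel a b c)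
  (@laplace_kernel_ge0 a b c).
Qed.

Variables (a b c : R).
Hypotheses (a1 : -1 < a) (b1 : -1 < b) (c0 : 0 < c) (abc : a - b < c).

Lemma measurable_weightW n : measurable_fun D (fun x => x ^+ n * weightW a b c x).
Proof.
apply: measurable_funM; first exact: measurable_funTS.
apply: measurable_funM; first exact: measurable_cst.
apply: measurable_funM.
  apply: measurable_funM; last exact: measurable_funTS (measurable_powR _).
  by apply/measurable_funTS/measurable_expR_comp; exact: oppr_measurable.
apply: measurable_funM; first exact: measurable_cst.
exact: (measurableT_comp _ (@measurable_laplace_int a b c)).
Qed.

Lemma weightW_ge0 x : 0 <= weightW a b c x.
Proof.
have a0 : 0 < a + 1 by rewrite -ltrBlDr sub0r.
have b0 : 0 < b + 1 by rewrite -ltrBlDr sub0r.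
have cb0 : 0 < c + b + 1 by rewrite -addrA addr_gt0.
rewrite /weightW; apply: mulr_ge0.
  by apply: divr_ge0; [|apply: mulr_ge0]; apply/ltW/Gamma_gt0.
apply: mulr_ge0; first by apply: mulr_ge0; [exact: expR_ge0|exact: powR_ge0].
apply: mulr_ge0; first by rewrite invr_ge0; apply/ltW/Gamma_gt0.
by apply: Rintegral_ge0 => t _; exact: laplace_kernel_ge0.
Qed.

(** The x-integral contributes [Gamma (a+1+n)]; the remaining t-integral is the
    Beta integral [B(c, b+1+n)], because the exponents of [t + 1] add up to
    [- (c + b + 1 + n)].  The normalization leaves Pochhammer symbols. *)
Lemma integral_weightW n :
  (\int[mu]_(x in D) (x ^+ n * weightW a b c x)%:E = (moment_seq a b (c + b + 1) n)%:E)%E.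
Proof.
have a0 : 0 < a + 1 by rewrite -ltrBlDr sub0r.
have b0 : 0 < b + 1 by rewrite -ltrBlDr sub0r.
have cb0 : 0 < c + b + 1 by rewrite -addrA addr_gt0.
pose K := Gamma (c + b + 1) / (Gamma (a + 1) * Gamma (b + 1)) / Gamma c.
transitivity (\int[mu]_(x in D) (K%:E *
    ((x `^ (a + 1 + n%:R - 1) * expR (- x))%:E * laplace_int a b c x)))%E.
  apply: eq_integral => x; rewrite inE /= in_itv /= andbT => x0.
  rewrite -(fineK (laplace_int_fin_num c0 abc x0)) -!EFinM; congr EFin.
  rewrite /weightW /TricomiU -[\int[mu]_(t in D) _]/(fine (laplace_int a b c x)).
  have -> : a + 1 + n%:R - 1 = a + n%:R by ring.
  rewrite powRD ?(gt_eqF x0) ?implybT// powR_mulrn ?(ltW x0)// /K.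
  by ring.
rewrite ge0_integralZl; last 4 first.
- exact: measurable_itv.
- apply: emeasurable_funM; last exact: measurable_laplace_int.
  exact: measurable_EFin_gamma_integrand.
- move=> x _; apply: mule_ge0; first by rewrite lee_fin gamma_integrand_ge0.
  by apply: integral_ge0 => t _; rewrite lee_fin laplace_kernel_ge0.
- rewrite lee_fin /K; apply: divr_ge0; last exact/ltW/Gamma_gt0.
  by apply: divr_ge0; [|apply: mulr_ge0]; apply/ltW/Gamma_gt0.
rewrite -(laplace_mellin_gamma _
  (g := fun t : R => t `^ (c - 1) * (t + 1) `^ (a - b + 1 - c - 1))); last 2 first.
- apply: measurable_funM; first exact: measurable_powR_comp.
  by apply: measurable_powR_comp; exact: measurable_funD.
- by move=> t; rewrite mulr_ge0 ?powR_ge0.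
rewrite -GammaE; last by rewrite ltr_wpDr.
rewrite (_ : (\int[mu]_(t in D) _)%E =
    (Gamma c * Gamma (b + 1 + n%:R) / Gamma (c + b + 1 + n%:R))%:E); last first.
  rewrite -(_ : c + (b + 1 + n%:R) = c + b + 1 + n%:R); last by ring.
  rewrite -beta_integral; [|exact: c0|by rewrite ltr_wpDr].
  apply: eq_integral => t; rewrite inE /= in_itv /= andbT => t0; congr EFin.
  rewrite -mulrA -powRD; last by rewrite (gt_eqF (addr_gt0 t0 ltr01)) implybT.
  by congr (_ * _ `^ _); ring.
rewrite -!EFinM !Gamma_poch// /K /moment_seq; congr EFin.
have P z : 0 < z -> poch z n != 0.
  by move=> z0; apply/prodf_neq0 => i _; rewrite gt_eqF// ltr_wpDr.
have [ga gb gc gcb] : [/\ Gamma (a + 1) != 0, Gamma (b + 1) != 0, Gamma c != 0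
    & Gamma (c + b + 1) != 0].
  by split; apply/lt0r_neq0/Gamma_gt0.
move: (P _ cb0) ga gb gc gcb; move: (Gamma _) (Gamma _) (Gamma _) (Gamma _) => x1 x2 x3 x4.
move: (poch _ _) (poch _ _) (poch _ _) => y1 y2 y3 yN xN1 xN2 xN3 xN4.
by field; rewrite yN xN1 xN2 xN3 xN4.
Qed.

Lemma integrable_weightW n : mu.-integrable D (EFin \o (fun x => x ^+ n * weightW a b c x)).
Proof.
apply/integrableP; split; first by apply/measurable_EFinP; exact: measurable_weightW.
rewrite (_ : (\int[mu]_(x in D) _)%E = (moment_seq a b (c + b + 1) n)%:E) ?ltry//.
rewrite -integral_weightW; apply: eq_integral => x; rewrite inE /= in_itv /= andbT => x0.
by rewrite ger0_norm// mulr_ge0 ?weightW_ge0// exprn_ge0// ltW.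
Qed.

Lemma moment_weightW k (u : {poly R}) :
  moment (weightW a b c) k u = moment_form (moment_seq a b (c + b + 1)) k u.
Proof.
rewrite /moment /moment_form /Rintegral.
transitivity (fine (\int[mu]_(x in D)
    (\sum_(i < size u) (u`_i)%:E * (x ^+ (k + i) * weightW a b c x)%:E)))%E.
  congr fine; apply: eq_integral => x _.
  under [RHS]eq_bigr do rewrite -EFinM.
  rewrite sumEFin; congr EFin; rewrite horner_coef mulr_sumr mulr_suml.
  by apply: eq_bigr => i _; rewrite exprD; ring.
rewrite integral_sum; [|exact: measurable_itv|].
  under eq_bigr => i _.
    rewrite integralZl; [|exact: measurable_itv|exact: integrable_weightW].
    rewrite integral_weightW -EFinM.
    over.
  by rewrite sumEFin.
by move=> i; apply: integrableZl; [exact: measurable_itv|exact: integrable_weightW].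
Qed.

End Moments.

(** * Polynomial growth *)

Section Asymptotics.
Variable R : realType.
Implicit Types (u v w : nat -> R) (l x y : R) (k j : nat).

(** Unlike [u ~ l m^k], this is closed under sums even when [l = 0]. *)
Definition grows k l u := u m / m%:R ^+ k @[m --> \oo] --> l.

Lemma cvg_natV : (m%:R^-1 : R) @[m --> \oo] --> (0 : R).
Proof.
rewrite -(cvg_shiftS (fun m => m%:R^-1 : R)); exact: cvg_harmonic.
Qed.

Lemma grows_affine x y : grows 1 x (fun m => x * m%:R + y).
Proof.
rewrite /grows.
have H : (fun m => x + y * m%:R^-1) @ \oo --> (x : R).
  rewrite -[X in _ --> X]addr0 -(mulr0 y).
  by apply: cvgD; [exact: cvg_cst|apply: cvgM; [exact: cvg_cst|exact: cvg_natV]].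
apply: cvg_trans H; apply: near_eq_cvg; near=> m.
have m0 : (m%:R : R) != 0 by rewrite pnatr_eq0 -lt0n; near: m; exists 1%N.
by rewrite expr1; field.
Unshelve. all: by end_near. Qed.

Arguments grows_affine : clear implicits.

Lemma grows_cst x : grows 0 x (fun=> x).
Proof. by rewrite /grows; under eq_fun do rewrite expr0 divr1; exact: cvg_cst. Qed.
Arguments grows_cst : clear implicits.

Lemma growsD k l1 l2 u v : grows k l1 u -> grows k l2 v -> grows k (l1 + l2) (u \+ v).
Proof.
move=> Hu Hv; rewrite /grows; under eq_fun do rewrite mulrDl; exact: cvgD.
Qed.

Lemma growsB k l1 l2 u v : grows k l1 u -> grows k l2 v -> grows k (l1 - l2) (u \- v).
Proof.
move=> Hu Hv; rewrite /grows; under eq_fun do rewrite mulrBl; exact: cvgB.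
Qed.

Lemma growsM k j l1 l2 u v : grows k l1 u -> grows j l2 v -> grows (k + j) (l1 * l2) (u \* v).
Proof.
move=> Hu Hv; rewrite /grows; under eq_fun do rewrite exprD invfM mulrACA; exact: cvgM.
Qed.

Lemma growsV k j l1 l2 u v : l2 != 0 -> (j <= k)%N ->
  grows k l1 u -> grows j l2 v -> grows (k - j) (l1 / l2) (fun m => u m / v m).
Proof.
move=> l20 jk Hu Hv.
have H : (fun m => (u m / m%:R ^+ k) / (v m / m%:R ^+ j)) @ \oo --> l1 / l2.
  by apply: cvgM => //; exact: cvgV.
apply: cvg_trans H; apply: near_eq_cvg; near=> m.
have m0 : (m%:R : R) != 0 by rewrite pnatr_eq0 -lt0n; near: m; exists 1%N.
have E : m%:R ^- (k - j) = m%:R ^- k * m%:R ^+ j :> R.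
  by rewrite -{2}(subnK jk) exprD invfM -mulrA mulVf ?mulr1// expf_neq0.
by rewrite E invfM invrK; ring.
Unshelve. all: by end_near. Qed.

Lemma grows_equiv k l u : l != 0 -> grows k l u ->
  asymptotically_equiv u (fun m => l * m%:R ^+ k).
Proof.
move=> l0 Hu; apply/eqaddoP => e e0.
have el0 : 0 < e * `|l| by rewrite mulr_gt0 // normr_gt0.
near=> m.
have m0 : (m%:R : R) != 0 by rewrite pnatr_eq0 -lt0n; near: m; exists 1%N.
have : `|l - u m / m%:R ^+ k| < e * `|l|.
  by near: m; move/cvgrPdist_lt: Hu => /(_ _ el0).
rewrite (_ : l - _ = (l * m%:R ^+ k - u m) / m%:R ^+ k); last first.
  by field; rewrite expf_neq0.
rewrite normrM normfV ltr_pdivrMr ?normr_gt0 ?expf_neq0// -mulrA -normrM distrC => /ltW H.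
exact: H.
Unshelve. all: by end_near. Qed.

Lemma grows_eq k l l' u v : grows k l' u -> l' = l ->
  (\forall m \near \oo, u m = v m) -> grows k l v.
Proof.
move=> Hu <- uv; apply: cvg_trans Hu; apply: near_eq_cvg.
by near=> m; congr (_ / _); near: m.
Unshelve. all: by end_near. Qed.

Lemma affine_neq0_near x y : 0 < x -> \forall m \near \oo, x * m%:R + y != 0 :> R.
Proof.
move=> x0; near=> m.
suff : - y < x * m%:R by move=> H; apply: lt0r_neq0; lra.
rewrite mulrC -ltr_pdivrMr//.
by near: m; exact: nbhs_infty_gtr.
Unshelve. all: by end_near. Qed.

Lemma grows_cubic a b y : grows 3 8 (fun m => cubic a b (2 * m%:R + y)).
Proof.
have H := growsM (growsM (grows_affine 2 y) (grows_affine 2 (a + y))) (grows_affine 2 (b + y)).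
apply: (grows_eq H); first by ring.
by near=> m; rewrite /cubic /=; ring.
Unshelve. all: by end_near. Qed.

(** Expanding [(x+1)(y+1)(z+1) - x y z] as a sum of three products of two
    factors exposes the growth of order 2. *)
Lemma grows_cubic_diff a b y :
  grows 2 12 (fun m => cubic a b (2 * m%:R + y + 1) - cubic a b (2 * m%:R + y)).
Proof.
have A z := grows_affine 2 z.
have H := growsD (growsD (growsM (A (y + 1)) (A (a + y + 1))) (growsM (A (b + y)) (A (y + 1))))
                 (growsM (A (b + y)) (A (a + y))).
apply: (grows_eq H); first by ring.
by near=> m; rewrite /cubic /=; ring.
Unshelve. all: by end_near. Qed.

Lemma grows_cubic_diff2 a b y :
  grows 1 12 (fun m => cubic a b (2 * m%:R + y + 1) - 2 * cubic a b (2 * m%:R + y)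
                       + cubic a b (2 * m%:R + y - 1)).
Proof.
apply: (grows_eq (grows_affine 12 (6 * y + 2 * a + 2 * b))) => //.
by near=> m; rewrite /cubic /=; ring.
Unshelve. all: by end_near. Qed.

(** Two terms of order 2 nearly cancel.  With [u] the cubic, the difference is
    [(u (s+1) - u s) / (g+z) - z u s / (g (g+z))], whose terms have order 1. *)
Lemma grows_beta a b y h z :
  grows 1 (4 - z * (8 / 9)) (fun m => cubic a b (2 * m%:R + y + 1) / (3 * m%:R + h + z) -
    cubic a b (2 * m%:R + y) / (3 * m%:R + h)).
Proof.
have three : (3 : R) != 0 by [].
have nine : (3 : R) * 3 != 0 by rewrite mulf_neq0.
have three0 : 0 < (3 : R) by [].
have H := growsB (growsV three (isT : 1 <= 2)%N (grows_cubic_diff a b y) (grows_affine 3 (h + z)))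
  (growsM (grows_cst z)
    (growsV nine (isT : 2 <= 3)%N (grows_cubic a b y)
      (growsM (grows_affine 3 h) (grows_affine 3 (h + z))))).
apply: (grows_eq H); first by field.
near=> m => /=.
have h1 : 3 * m%:R + (h + z) != 0 :> R by near: m; exact: affine_neq0_near.
have h2 : 3 * m%:R + h != 0 :> R by near: m; exact: affine_neq0_near.
rewrite addrA in h1 *.
by field; rewrite h1 h2.
Unshelve. all: by end_near. Qed.

(** Terms of order 2 cancel twice in the second factor.  It equals half of
    [(u (s+1) - 2 u s + u (s-1)) / (g+1) - 2 (u s - u (s-1)) / ((g-1)(g+1))
     + 2 u s / (g (g-1)(g+1))], whose terms have order 0. *)
Lemma grows_alpha a b y h :
  grows 2 (208 / 81) (fun m => cubic a b (2 * m%:R + y) / (3 * m%:R + h) *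
   (cubic a b (2 * m%:R + y - 1) / (2 * (3 * m%:R + h - 1)) -
    cubic a b (2 * m%:R + y) / (3 * m%:R + h) +
    cubic a b (2 * m%:R + y + 1) / (2 * (3 * m%:R + h + 1)))).
Proof.
have three : (3 : R) != 0 by [].
have nine : (3 : R) * 3 != 0 by rewrite mulf_neq0.
have t7 : (3 : R) * 3 * 3 != 0 by rewrite !mulf_neq0.
have three0 : 0 < (3 : R) by [].
have G z := grows_affine 3 (h + z).
have U := grows_cubic a b y.
have D0 := grows_cubic_diff a b (y - 1).
have H := growsM (growsV three (isT : 1 <= 3)%N U (G 0)) (growsM (grows_cst 2^-1)
  (growsD (growsB (growsV three (isT : 1 <= 1)%N (grows_cubic_diff2 a b y) (G 1))
    (growsM (grows_cst 2) (growsV nine (isT : 2 <= 2)%N D0 (growsM (G (- 1)) (G 1)))))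
    (growsM (grows_cst 2) (growsV t7 (isT : 3 <= 3)%N U
      (growsM (growsM (G 0) (G (-1))) (G 1)))))).
apply: (grows_eq H); first by field.
near=> m => /=.
have h1 : 3 * m%:R + (h + 1) != 0 :> R by near: m; exact: affine_neq0_near.
have h2 : 3 * m%:R + h != 0 :> R by near: m; exact: affine_neq0_near.
have h3 : 3 * m%:R + (h - 1) != 0 :> R by near: m; exact: affine_neq0_near.
have -> : 2 * m%:R + (y - 1) + 1 = 2 * m%:R + y by ring.
rewrite !addrA !addr0 in h1 h2 h3 *.
move: (cubic a b _) (cubic a b _) (cubic a b _) => u2 u1 u0.
by field; rewrite h1 h2 h3.
Unshelve. all: by end_near. Qed.

Lemma grows_gamma_odd a b y h :
  grows 3 (2 ^+ 6 / 3 ^+ 3) (fun m => cubic a b (2 * m%:R + y) * cubic a b (2 * m%:R + y + 1) /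
   ((3 * m%:R + h) * (3 * m%:R + h + 1) * (3 * m%:R + h + 2))).
Proof.
have t7 : (3 : R) * 3 * 3 != 0 by rewrite !mulf_neq0.
have G z := grows_affine 3 (h + z).
have H := growsV t7 (isT : 3 <= 6)%N (growsM (grows_cubic a b y) (grows_cubic a b (y + 1)))
  (growsM (growsM (G 0) (G 1)) (G 2)).
apply: (grows_eq H); first by field.
by near=> m => /=; rewrite !addrA addr0.
Unshelve. all: by end_near. Qed.

Lemma grows_gamma_even a b y h x1 x2 x3 :
  grows 3 (2 ^+ 6 / 3 ^+ 6) (fun m => cubic a b (2 * m%:R + y) * cubic a b (2 * m%:R + y + 1) /
   ((3 * m%:R + h) * (3 * m%:R + h + 1) * (3 * m%:R + h + 2)) *
   ((m%:R + x1) * (m%:R + x2) * (m%:R + x3) /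
     ((3 * m%:R + h - 1) * (3 * m%:R + h) * (3 * m%:R + h + 1)))).
Proof.
have t7 : (3 : R) * 3 * 3 != 0 by rewrite !mulf_neq0.
have G z := grows_affine 3 (h + z).
have A z := grows_affine 1 z.
have H := growsM (grows_gamma_odd a b y h)
  (growsV t7 (isT : 3 <= 3)%N (growsM (growsM (A x1) (A x2)) (A x3))
     (growsM (growsM (G (-1)) (G 0)) (G 1))).
apply: (grows_eq H); first by field.
by near=> m => /=; rewrite !addrA !addr0 !mul1r.
Unshelve. all: by end_near. Qed.

End Asymptotics.

(** * Closed forms of the recurrence coefficients *)

Section ClosedForms.
Variables (R : realType) (a b c : R) (d : nat).
Hypothesis d1 : (d <= 1)%N.

(** In [_even] lemmas the superscript and the index [2m + d] have an even sum, in
    [_odd] lemmas an odd one; the half-sum is [m + d], respectively [m]. *)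
Lemma half_even m : odd (2 * m + d + d) = false /\ ((2 * m + d + d)./2 = m + d)%N.
Proof. by split; lia. Qed.

Lemma half_odd m : odd (2 * m + d + (1 - d)) = true /\ ((2 * m + d + (1 - d))./2 = m)%N.
Proof. by split; lia. Qed.

Lemma rec_denom_even c' m : rec_denom d b c' (2 * m + d)%N = 3 * m%:R + (c' + b + 2 * d%:R).
Proof. by rewrite /rec_denom (half_even m).2 !natrD; ring. Qed.

Lemma rec_denom_odd c' m : rec_denom (1 - d)%N b c' (2 * m + d)%N = 3 * m%:R + (c' + b + d%:R).
Proof. by rewrite /rec_denom (half_odd m).2 natrD; ring. Qed.

Lemma rec_beta_even m : rec_beta d a b c (2 * m + d)%N =
  cubic a b (2 * m%:R + d%:R + 1) / (3 * m%:R + (c + b + 2 * d%:R) + 1) -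
  cubic a b (2 * m%:R + d%:R) / (3 * m%:R + (c + b + 2 * d%:R)).
Proof. by rewrite /rec_beta rec_denom_even (half_even m).1 addr0 natrD natrM. Qed.

Lemma rec_beta_odd m : rec_beta (1 - d)%N a b c (2 * m + d)%N =
  cubic a b (2 * m%:R + d%:R + 1) / (3 * m%:R + (c + b + d%:R) + 2) -
  cubic a b (2 * m%:R + d%:R) / (3 * m%:R + (c + b + d%:R)).
Proof.
rewrite /rec_beta rec_denom_odd (half_odd m).1 natrD natrM /=.
by congr (_ / _ - _); ring.
Qed.

Lemma rec_alpha_even m : rec_alpha d a b c (2 * m + d)%N =
  cubic a b (2 * m%:R + d%:R) / (3 * m%:R + (c + b + 2 * d%:R)) *
   (cubic a b (2 * m%:R + d%:R - 1) / (2 * (3 * m%:R + (c + b + 2 * d%:R) - 1)) -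
    cubic a b (2 * m%:R + d%:R) / (3 * m%:R + (c + b + 2 * d%:R)) +
    cubic a b (2 * m%:R + d%:R + 1) / (2 * (3 * m%:R + (c + b + 2 * d%:R) + 1))).
Proof. by rewrite /rec_alpha rec_denom_even natrD natrM. Qed.

(** [rec_alpha] depends on the parity only through [rec_denom], and raising [c]
    by [d] compensates for the different half-sums. *)
Lemma rec_alpha_odd m :
  rec_alpha (1 - d)%N a b (c + d%:R) (2 * m + d)%N = rec_alpha d a b c (2 * m + d)%N.
Proof.
rewrite /rec_alpha rec_denom_even rec_denom_odd.
by have -> : c + d%:R + b + d%:R = c + b + 2 * d%:R by ring.
Qed.

Lemma rec_gamma_even m : rec_gamma d a b c (2 * m + d)%N =
  cubic a b (2 * m%:R + d%:R) * cubic a b (2 * m%:R + d%:R + 1) /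
   ((3 * m%:R + (c + b + 2 * d%:R)) * (3 * m%:R + (c + b + 2 * d%:R) + 1) *
    (3 * m%:R + (c + b + 2 * d%:R) + 2)) *
   ((m%:R + (c + d%:R)) * (m%:R + (c + b - a + d%:R)) * (m%:R + (c + b + d%:R)) /
     ((3 * m%:R + (c + b + 2 * d%:R) - 1) * (3 * m%:R + (c + b + 2 * d%:R)) *
      (3 * m%:R + (c + b + 2 * d%:R) + 1))).
Proof.
rewrite /rec_gamma rec_denom_even (half_even m).1 (half_even m).2.
rewrite (natrD _ (2 * m)) natrM (natrD _ m).
by congr (_ * (_ * _ * _ / _)); ring.
Qed.

Lemma rec_gamma_odd m : rec_gamma (1 - d)%N a b c (2 * m + d)%N =
  cubic a b (2 * m%:R + d%:R) * cubic a b (2 * m%:R + d%:R + 1) /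
   ((3 * m%:R + (c + b + d%:R)) * (3 * m%:R + (c + b + d%:R) + 1) *
    (3 * m%:R + (c + b + d%:R) + 2)).
Proof.
by rewrite /rec_gamma rec_denom_odd (half_odd m).1 (natrD _ (2 * m)) natrM mulr1.
Qed.

End ClosedForms.

(** * The main theorem *)

Section WeightVector.
Variables (R : realType) (a b c : R) (d : nat).
Hypotheses (a1 : -1 < a) (b1 : -1 < b) (c0 : 0 < c) (abc : a - b < c) (d1 : (d <= 1)%N).

Let w := weight_vec d a b c.

Lemma stepline_functionalE j p :
  stepline_functional a b c d j p = moment (if odd j then w.2 else w.1) j./2 p.
Proof.
have ge0 k : 0 <= k%:R :> R by [].
rewrite /stepline_functional /w /weight_vec; case: ifP => _ /=.
  have -> : c + 1 - d%:R = c + (1 - d)%N%:R by rewrite natrB// addrA.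
  rewrite moment_weightW //; [|by rewrite ltr_wpDr|by rewrite ltr_wpDr].
  by congr (moment_form (moment_seq _ _ _) _ _); ring.
rewrite moment_weightW //; [|by rewrite ltr_wpDr|by rewrite ltr_wpDr].
by congr (moment_form (moment_seq _ _ _) _ _); ring.
Qed.

Lemma monic_two_orthogonal_recurrence P : monic_two_orthogonal w P ->
  third_order_recurrence P (rec_beta d a b c) (rec_alpha d a b c) (rec_gamma d a b c).
Proof.
move=> [[sP oP] mP]; apply: two_orthogonal_recurrence => //; first by move: b1 c0; lra.
- move=> j n jn; rewrite stepline_functionalE; have [z1 _ z2 _] := oP j./2 n.
  by move: z1 z2; case: ifP => oj z1 z2; [apply: z2|apply: z1]; lia.
- move=> j; rewrite stepline_functionalE; have [_ z1 _ z2] := oP j./2 j.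
  by move: z1 z2; case: ifP => oj z1 z2; [apply: z2|apply: z1]; lia.
Qed.

Lemma rec_gamma_gt0 n : (1 <= n)%N -> 0 < rec_gamma d a b c n.
Proof.
move=> n1; have nR : 1 <= n%:R :> R by rewrite ler1n.
have u0 x : 1 <= x -> 0 < cubic a b x by move=> x1; rewrite /cubic !mulr_gt0//; move: a1 b1; lra.
have e0 : 0 <= ((n + d)./2)%:R :> R by [].
rewrite /rec_gamma mulr_gt0//.
  by rewrite divr_gt0 ?mulr_gt0 ?u0//; rewrite /rec_denom; move: a1 b1 c0 abc; lra.
case: ifP => // od.
have e1 : 1 <= ((n + d)./2)%:R :> R by rewrite ler1n; lia.
by rewrite divr_gt0 ?mulr_gt0//; rewrite /rec_denom; move: a1 b1 c0 abc; lra.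
Qed.

End WeightVector.

Theorem theorem3p4 (R : realType) :
  exists beta alpha gamma : nat -> R -> R -> R -> nat -> R,
  forall (a b c : R) (d : nat),
    -1 < a -> -1 < b -> Num.max 0 (a - b) < c -> (d <= 1)%N ->
    (forall P : nat -> {poly R},
       monic_two_orthogonal (weight_vec d a b c) P ->
       third_order_recurrence P (beta d a b c) (alpha d a b c) (gamma d a b c))
    /\
    (forall m : nat,
       let s : R := (2 * m + d)%:R in
       [/\ beta d a b c (2 * m + d)%N =
             (s + 1) * (a + s + 1) * (b + s + 1)
               / (c + b + 3 * m%:R + 2 * d%:R + 1)
             - (if (2 * m + d == 0)%N then 0 else
                s * (a + s) * (b + s) / (c + b + 3 * m%:R + 2 * d%:R)),
           beta (1 - d)%N a b c (2 * m + d)%N =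
             (s + 1) * (a + s + 1) * (b + s + 1)
               / (c + b + 3 * m%:R + d%:R + 2)
             - (if (2 * m + d == 0)%N then 0 else
                s * (a + s) * (b + s) / (c + b + 3 * m%:R + d%:R))
         & (1 <= 2 * m + d)%N ->
           [/\ alpha (1 - d)%N a b (c + d%:R) (2 * m + d)%N =
                 alpha d a b c (2 * m + d)%N,
               alpha d a b c (2 * m + d)%N =
                 s * (a + s) * (b + s) / (c + b + 3 * m%:R + 2 * d%:R) *
                 ((s - 1) * (a + s - 1) * (b + s - 1)
                    / (2 * (c + b + 3 * m%:R + 2 * d%:R - 1))
                  - s * (a + s) * (b + s) / (c + b + 3 * m%:R + 2 * d%:R)
                  + (s + 1) * (a + s + 1) * (b + s + 1)
                    / (2 * (c + b + 3 * m%:R + 2 * d%:R + 1))),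
               gamma d a b c (2 * m + d)%N =
                 poch s 2 * poch (a + s) 2 * poch (b + s) 2
                 * (c + m%:R + d%:R) * (c + b - a + m%:R + d%:R)
                 * (c + b + m%:R + d%:R)
                 / (poch (c + b + 3 * m%:R - 1 + 2 * d%:R) 3
                    * poch (c + b + 3 * m%:R + 2 * d%:R) 3)
             & gamma (1 - d)%N a b c (2 * m + d)%N =
                 poch s 2 * poch (a + s) 2 * poch (b + s) 2
                 / poch (c + b + 3 * m%:R + d%:R) 3]])
    /\
    (forall m : nat, (1 <= m)%N -> 0 < gamma d a b c m)
    /\
    [/\ asymptotically_equiv
          (fun m : nat => beta d a b c (2 * m + d)%N)
          (fun m : nat => 28 / 9 * m%:R),
        asymptotically_equiv
          (fun m : nat => beta (1 - d)%N a b c (2 * m + d)%N)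
          (fun m : nat => 20 / 9 * m%:R)
      & [/\ asymptotically_equiv
              (fun m : nat => alpha (1 - d)%N a b (c + d%:R) (2 * m + d)%N)
              (fun m : nat => 208 / 81 * m%:R ^+ 2),
            asymptotically_equiv
              (fun m : nat => alpha d a b c (2 * m + d)%N)
              (fun m : nat => 208 / 81 * m%:R ^+ 2),
            asymptotically_equiv
              (fun m : nat => gamma d a b c (2 * m + d)%N)
              (fun m : nat => 2 ^+ 6 / 3 ^+ 6 * m%:R ^+ 3)
          & asymptotically_equiv
              (fun m : nat => gamma (1 - d)%N a b c (2 * m + d)%N)
              (fun m : nat => 2 ^+ 6 / 3 ^+ 3 * m%:R ^+ 3)]].
Proof.
exists (@rec_beta R), (@rec_alpha R), (@rec_gamma R) => a b c d a1 b1.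
rewrite gt_max => /andP[c0 abc] d1; split; last split; last split.
- by move=> P; exact: monic_two_orthogonal_recurrence.
- move=> m s.
  have sE : s = 2 * m%:R + d%:R by rewrite /s natrD natrM.
  (* The case distinction at index 0 is absorbed by [cubic a b 0 = 0]. *)
  have s0 : (if (2 * m + d == 0)%N then 0 else s * (a + s) * (b + s)) = cubic a b s.
    by rewrite /cubic /s; case: eqP => [->|//]; rewrite !mul0r.
  have ifE x : (if (2 * m + d == 0)%N then 0 else s * (a + s) * (b + s) / x) = cubic a b s / x.
    by rewrite -s0; case: ifP => //; rewrite mul0r.
  have poch2 x : poch x 2 = x * (x + 1) by rewrite /poch !big_ord_recl big_ord0 mulr1 addr0.
  have poch3 x : poch x 3 = x * (x + 1) * (x + 2).
    by rewrite /poch !big_ord_recl big_ord0 mulr1 addr0 mulrA.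
  split.
  + by rewrite rec_beta_even// ifE -sE /cubic; congr (_ / _ - _ / _); ring.
  + by rewrite rec_beta_odd// ifE -sE /cubic; congr (_ / _ - _ / _); ring.
  move=> n1; split.
  + exact: rec_alpha_odd.
  + rewrite rec_alpha_even// -sE /cubic.
    by congr (_ / _ * (_ / (_ * _) - _ / _ + _ / (_ * _))); ring.
  + rewrite rec_gamma_even// -sE /cubic !poch2 !poch3.
    rewrite mulf_div; congr (_ / _); ring.
  + rewrite rec_gamma_odd// -sE /cubic !poch2 !poch3.
    by congr (_ / _); ring.
- by move=> m; exact: rec_gamma_gt0.
have equivE k l (u v : nat -> R) : l != 0 -> u =1 v -> grows k l v ->
    asymptotically_equiv u (fun m => l * m%:R ^+ k).
  by move=> l0 uv Hv; apply: grows_equiv => //; rewrite (funext uv).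
have aE := rec_alpha_even a b c d1.
split; [| |split].
- apply: (equivE 1%N _ _ _ _ (rec_beta_even a b c d1)) => //.
  have -> : 28 / 9 = 4 - 1 * (8 / 9) :> R by field.
  exact: grows_beta.
- apply: (equivE 1%N _ _ _ _ (rec_beta_odd a b c d1)) => //.
  have -> : 20 / 9 = 4 - 2 * (8 / 9) :> R by field.
  exact: grows_beta.
- apply: (equivE 2%N _ _ _ _ (fun m => etrans (rec_alpha_odd a b c d1 m) (aE m))) => //.
  exact: grows_alpha.
- by apply: (equivE 2%N _ _ _ _ aE) => //; exact: grows_alpha.
- apply: (equivE 3%N _ _ _ _ (rec_gamma_even a b c d1)); last exact: grows_gamma_even.
  by rewrite mulf_neq0 ?invr_neq0 ?expf_neq0.
- apply: (equivE 3%N _ _ _ _ (rec_gamma_odd a b c d1)); last exact: grows_gamma_odd.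
  by rewrite mulf_neq0 ?invr_neq0 ?expf_neq0.
Qed.
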